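(* Consider a degenerate elliptic PDE $$F(x,u(x),\nabla u(x),D^2u(x))=0,\qquad x\in\bar\Omega,$$ on a bounded domain $\Omega$ (boundary conditions being included in $F$). Suppose that the PDE operator satisfies an interior comparison principle and that there exist strict classical sub- and super-solutions of the PDE. Let $F^h$ be any consistent, monotone, Lipschitz scheme and $U^h:\mathcal{G}^h\to\mathbb{R}$ any solution of the scheme $F^h(x,U^h(x),U^h(x)-U^h(\cdot))=0$, $x\in\mathcal{G}^h$. Then for any interior point $x\in\Omega$, the piecewise constant extension $u^h(x)$ converges, as $h\to0$, to $u(x)$, where $u$ is the viscosity solution of the PDE.
   Context: PDE. $\Omega\subset\mathbb{R}^n$ is a bounded domain, $\mathcal{S}^n$ is the space of symmetric $n\times n$ matrices, and $F:\bar\Omega\times\mathbb{R}\times\mathbb{R}^n\times\mathcal{S}^n\to\mathbb{R}$ is degenerate elliptic: $F(x,u,p,X)\le F(x,v,p,Y)$ whenever $u\le v$ and $X\ge Y$. $F^*$ and $F_*$ denote the upper and lower semi-continuous envelopes of $F$. A bounded upper (lower) semi-continuous $u$ on $\bar\Omega$ is a viscosity sub-solution (super-solution) if for every $\phi\in C^2(\bar\Omega)$, whenever $u-\phi$ has a local maximum (minimum), relative to $\bar\Omega$, at $x\in\bar\Omega$, then $F_*(x,u(x),\nabla\phi(x),D^2\phi(x))\le0$ (respectively $F^*(x,u(x),\nabla\phi(x),D^2\phi(x))\ge0$). A bounded $u:\Omega\to\mathbb{R}$ is a viscosity solution if $u^*(x)=\limsup_{\Omega\ni y\to x}u(y)$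 ($x\in\bar\Omega$) is a sub-solution and $u_*(x)=\liminf_{\Omega\ni y\to x}u(y)$ is a super-solution. Interior comparison principle: if $u$ is a bounded upper semi-continuous sub-solution and $v$ a bounded lower semi-continuous super-solution, then $u\le v$ on $\Omega$. A function $u\in C^2(\bar\Omega)$ is a strict classical sub-solution (super-solution) if there is $\mu>0$ with $F^*(x,u(x),\nabla u(x),D^2u(x))\le-\mu$ (respectively $F_*(x,u(x),\nabla u(x),D^2u(x))\ge\mu$) for every $x\in\bar\Omega$. Schemes. For each small $h>0$, $\mathcal{G}^h\subset\bar\Omega$ is a finite set of discretisation points, with $\lim_{h\to0}\sup_{y\in\Omega}\min_{x\in\mathcal{G}^h}|x-y|=0$. A scheme is a family of maps $F^h$ giving equations $F^h(x,u(x),u(x)-u(\cdot))=0$, $x\in\mathcal{G}^h$, for grid functions $u:\mathcal{G}^h\to\mathbb{R}$; its arguments are a grid point, a real number, and a function on $\mathcal{G}^h$. It is - consistent if for any smooth $\phi$ and $x\in\bar\Omega$, $\limsup_{h\to0,\,y\to x,\,z\in\mathcal{G}^h\to x,\,\xi\to0}F^h(z,\phi(y)+\xi,\phi(y)-\phi(\cdot))\le F^*(x,\phi(x),\nabla\phi(x),D^2\phi(x))$ and $\liminf_{h\to0,\,y\to x,\,z\in\mathcal{G}^h\to x,\,\xi\to0}F^h(z,\phi(y)+\xi,\phi(y)-\phi(\cdot))\ge F_*(x,\phi(x),\nabla\phi(x),D^2\phi(x))$; - monotone if $F^h$ is a non-decreasing function of its final two arguments; - Lipschitz if $F^h$ is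 locally Lipschitz continuous in its final two arguments. Extension: for $x\in\bar\Omega$, $u^h(x)=\max\{U^h(y): y\in\mathcal{G}^h,\ |y-x|=\min_{z\in\mathcal{G}^h}|z-x|\}$. *)

(* Defs.v *)
From HB Require Import structures.
From mathcomp Require Import all_boot all_order all_algebra.
From mathcomp Require Import all_classical all_reals all_analysis.

Set Implicit Arguments.
Unset Strict Implicit.
Unset Printing Implicit Defensive.

Import Order.TTheory GRing.Theory Num.Theory.
Import numFieldNormedType.Exports.

Local Open Scope classical_set_scope.
Local Open Scope ring_scope.

(* R^n is ['rV[R]_n].  A function on a subset of R^n is represented by a total
   function; every definition below uses its values on that subset only. *)

(* The library norm on matrices is the sup norm, which defines the same topology
   but not the same nearest points. *)
Definition enorm (R : realType) (n : nat) (x : 'rV[R]_n) : R :=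
  Num.sqrt (\sum_(i < n) x 0 i ^+ 2).

Definition bounded_domain (R : realType) (n : nat) (Om : set 'rV[R]_n) : Prop :=
  [/\ open Om, connected Om, Om !=set0 & bounded_set Om].

Definition partial (R : realType) (n : nat) (i : 'I_n) (f : 'rV[R]_n -> R) :
    'rV[R]_n -> R :=
  fun x => 'D_(delta_mx 0 i) f x.

(* C^k on the whole of R^n; C^k(closure Om) is the set of restrictions of such
   functions.  As [Om] is open, the derivatives on [closure Om] of a C^k function
   depend only on its restriction. *)
Fixpoint Ck (R : realType) (n : nat) (k : nat) (f : 'rV[R]_n -> R) : Prop :=
  continuous f /\
  if k is k'.+1 then
    forall i : 'I_n, (forall x, derivable f x (delta_mx 0 i)) /\
                     Ck k' (partial i f)
  else True.

Definition smooth (R : realType) (n : nat) (f : 'rV[R]_n -> R) : Prop :=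
  forall k, Ck k f.

Definition grad (R : realType) (n : nat) (f : 'rV[R]_n -> R) (x : 'rV[R]_n) :
    'rV[R]_n :=
  \row_i partial i f x.

Definition hess (R : realType) (n : nat) (f : 'rV[R]_n -> R) (x : 'rV[R]_n) :
    'M[R]_n :=
  \matrix_(i, j) partial i (partial j f) x.

Definition symmx (R : realType) (n : nat) (X : 'M[R]_n) : Prop := X^T = X.

Definition psdmx (R : realType) (n : nat) (X : 'M[R]_n) : Prop :=
  forall v : 'rV[R]_n, 0 <= (v *m X *m v^T) 0 0.

Definition pde_operator (R : realType) (n : nat) :=
  'rV[R]_n -> R -> 'rV[R]_n -> 'M[R]_n -> R.

Definition degenerate_elliptic (R : realType) (n : nat) (Om : set 'rV[R]_n)
    (F : pde_operator R n) : Prop :=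
  forall x u v p X Y, closure Om x -> symmx X -> symmx Y ->
    u <= v -> psdmx (X - Y) -> F x u p X <= F x v p Y.

(* Neighbourhoods of (x, u, p, X) in closure Om * R * R^n * S^n, the set on which
   the semicontinuous envelopes are taken. *)
Definition jet_nbhs (R : realType) (n : nat) (Om : set 'rV[R]_n)
    (x : 'rV[R]_n) (u : R) (p : 'rV[R]_n) (X : 'M[R]_n) :
    set_system ('rV[R]_n * R * 'rV[R]_n * 'M[R]_n) :=
  within [set j | closure Om j.1.1.1 /\ symmx j.2] (nbhs (x, u, p, X)).

(* [F] need not be locally bounded, so its envelopes are extended-real-valued. *)
Definition upper_env (R : realType) (n : nat) (Om : set 'rV[R]_n)
    (F : pde_operator R n) (x : 'rV[R]_n) (u : R) (p : 'rV[R]_n) (X : 'M[R]_n) :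
    \bar R :=
  limf_esup (fun j => (F j.1.1.1 j.1.1.2 j.1.2 j.2)%:E) (jet_nbhs Om x u p X).

Definition lower_env (R : realType) (n : nat) (Om : set 'rV[R]_n)
    (F : pde_operator R n) (x : 'rV[R]_n) (u : R) (p : 'rV[R]_n) (X : 'M[R]_n) :
    \bar R :=
  limf_einf (fun j => (F j.1.1.1 j.1.1.2 j.1.2 j.2)%:E) (jet_nbhs Om x u p X).

Definition bounded_on (R : realType) (n : nat) (A : set 'rV[R]_n)
    (u : 'rV[R]_n -> R) : Prop :=
  exists M : R, forall x, A x -> `|u x| <= M.

Definition usc_on (R : realType) (n : nat) (A : set 'rV[R]_n)
    (u : 'rV[R]_n -> R) : Prop :=
  forall x a, A x -> u x < a -> \forall y \near within A (nbhs x), u y < a.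

Definition lsc_on (R : realType) (n : nat) (A : set 'rV[R]_n)
    (u : 'rV[R]_n -> R) : Prop :=
  forall x a, A x -> a < u x -> \forall y \near within A (nbhs x), a < u y.

Definition local_max_on (R : realType) (n : nat) (A : set 'rV[R]_n)
    (f : 'rV[R]_n -> R) (x : 'rV[R]_n) : Prop :=
  \forall y \near within A (nbhs x), f y <= f x.

Definition local_min_on (R : realType) (n : nat) (A : set 'rV[R]_n)
    (f : 'rV[R]_n -> R) (x : 'rV[R]_n) : Prop :=
  \forall y \near within A (nbhs x), f x <= f y.

Definition viscosity_subsolution (R : realType) (n : nat) (Om : set 'rV[R]_n)
    (F : pde_operator R n) (u : 'rV[R]_n -> R) : Prop :=
  [/\ bounded_on (closure Om) u, usc_on (closure Om) u &
    forall phi, Ck 2 phi -> forall x, closure Om x ->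
      local_max_on (closure Om) (u \- phi) x ->
      (lower_env Om F x (u x) (grad phi x) (hess phi x) <= 0%:E)%E].

Definition viscosity_supersolution (R : realType) (n : nat) (Om : set 'rV[R]_n)
    (F : pde_operator R n) (u : 'rV[R]_n -> R) : Prop :=
  [/\ bounded_on (closure Om) u, lsc_on (closure Om) u &
    forall phi, Ck 2 phi -> forall x, closure Om x ->
      local_min_on (closure Om) (u \- phi) x ->
      (0%:E <= upper_env Om F x (u x) (grad phi x) (hess phi x))%E].

(* limsup and liminf of [u] at [x] along [Om], the value at [x] being included
   when [x] is in [Om]; [fine] is harmless as [u] is bounded on [Om]. *)
Definition usc_ext (R : realType) (n : nat) (Om : set 'rV[R]_n)
    (u : 'rV[R]_n -> R) (x : 'rV[R]_n) : R :=
  fine (limf_esup (fun y => (u y)%:E) (within Om (nbhs x))).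

Definition lsc_ext (R : realType) (n : nat) (Om : set 'rV[R]_n)
    (u : 'rV[R]_n -> R) (x : 'rV[R]_n) : R :=
  fine (limf_einf (fun y => (u y)%:E) (within Om (nbhs x))).

Definition viscosity_solution (R : realType) (n : nat) (Om : set 'rV[R]_n)
    (F : pde_operator R n) (u : 'rV[R]_n -> R) : Prop :=
  [/\ bounded_on Om u, viscosity_subsolution Om F (usc_ext Om u) &
      viscosity_supersolution Om F (lsc_ext Om u)].

Definition interior_comparison (R : realType) (n : nat) (Om : set 'rV[R]_n)
    (F : pde_operator R n) : Prop :=
  forall u v, viscosity_subsolution Om F u -> viscosity_supersolution Om F v ->
    forall x, Om x -> u x <= v x.

Definition strict_classical_subsolution (R : realType) (n : nat)
    (Om : set 'rV[R]_n) (F : pde_operator R n) (u : 'rV[R]_n -> R) : Prop :=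
  Ck 2 u /\ exists mu : R, 0 < mu /\ forall x, closure Om x ->
    (upper_env Om F x (u x) (grad u x) (hess u x) <= (- mu)%:E)%E.

Definition strict_classical_supersolution (R : realType) (n : nat)
    (Om : set 'rV[R]_n) (F : pde_operator R n) (u : 'rV[R]_n -> R) : Prop :=
  Ck 2 u /\ exists mu : R, 0 < mu /\ forall x, closure Om x ->
    (mu%:E <= lower_env Om F x (u x) (grad u x) (hess u x))%E.

(* [G h] is the set of grid points.  "For each small h > 0" is rendered by
   [\forall h \near 0^'+].  Nonemptiness is needed for the minimum in the last
   clause, since [inf set0 = 0]. *)
Definition discretisation (R : realType) (n : nat) (Om : set 'rV[R]_n)
    (G : R -> set 'rV[R]_n) : Prop :=
  [/\ \forall h \near (0 : R)^'+,
        [/\ finite_set (G h), G h !=set0 & G h `<=` closure Om] &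
      sup [set inf [set enorm (x - y) | x in G h] | y in Om]
        @[h --> (0 : R)^'+] --> (0 : R)].

Definition scheme (R : realType) (n : nat) :=
  R -> 'rV[R]_n -> R -> ('rV[R]_n -> R) -> R.

(* The last argument of a scheme is a function on the grid. *)
Definition grid_scheme (R : realType) (n : nat) (G : R -> set 'rV[R]_n)
    (Fh : scheme R n) : Prop :=
  \forall h \near (0 : R)^'+, forall z r f g, G h z ->
    (forall w, G h w -> f w = g w) -> Fh h z r f = Fh h z r g.

(* h -> 0+, y -> x, z -> x, xi -> 0 with y in closure Om and z in G h; the
   variable is t = (h, y, z, xi). *)
Definition scheme_filter (R : realType) (n : nat) (Om : set 'rV[R]_n)
    (G : R -> set 'rV[R]_n) (x : 'rV[R]_n) :
    set_system (R * 'rV[R]_n * 'rV[R]_n * R) :=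
  within [set t | closure Om t.1.1.2 /\ G t.1.1.1 t.1.2]
    (filter_prod (filter_prod (filter_prod (0 : R)^'+ (nbhs x)) (nbhs x))
                 (nbhs (0 : R))).

Definition scheme_value (R : realType) (n : nat) (Fh : scheme R n)
    (phi : 'rV[R]_n -> R) (t : R * 'rV[R]_n * 'rV[R]_n * R) : \bar R :=
  (Fh t.1.1.1 t.1.2 (phi t.1.1.2 + t.2) (fun w => phi t.1.1.2 - phi w))%:E.

Definition consistent (R : realType) (n : nat) (Om : set 'rV[R]_n)
    (F : pde_operator R n) (G : R -> set 'rV[R]_n) (Fh : scheme R n) : Prop :=
  forall phi, smooth phi -> forall x, closure Om x ->
    (limf_esup (scheme_value Fh phi) (scheme_filter Om G x)
       <= upper_env Om F x (phi x) (grad phi x) (hess phi x))%E /\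
    (lower_env Om F x (phi x) (grad phi x) (hess phi x)
       <= limf_einf (scheme_value Fh phi) (scheme_filter Om G x))%E.

Definition monotone_scheme (R : realType) (n : nat) (G : R -> set 'rV[R]_n)
    (Fh : scheme R n) : Prop :=
  \forall h \near (0 : R)^'+, forall z r s f g, G h z ->
    r <= s -> (forall w, G h w -> f w <= g w) -> Fh h z r f <= Fh h z s g.

(* Local Lipschitz continuity, for the maximum norm on R * R^(G h); the constants
   may depend on h. *)
Definition lipschitz_scheme (R : realType) (n : nat) (G : R -> set 'rV[R]_n)
    (Fh : scheme R n) : Prop :=
  \forall h \near (0 : R)^'+, forall z r0 f0, G h z ->
    exists d L : R, 0 < d /\ forall r s f g,
      `|r - r0| < d -> `|s - r0| < d ->
      (forall w, G h w -> `|f w - f0 w| < d) ->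
      (forall w, G h w -> `|g w - f0 w| < d) ->
      forall e : R, `|r - s| <= e -> (forall w, G h w -> `|f w - g w| <= e) ->
        `|Fh h z r f - Fh h z s g| <= L * e.

Definition scheme_solution (R : realType) (n : nat) (G : R -> set 'rV[R]_n)
    (Fh : scheme R n) (U : R -> 'rV[R]_n -> R) : Prop :=
  \forall h \near (0 : R)^'+, forall x, G h x ->
    Fh h x (U h x) (fun y => U h x - U h y) = 0.

Definition nearest (R : realType) (n : nat) (A : set 'rV[R]_n) (x : 'rV[R]_n) :
    set 'rV[R]_n :=
  [set y | A y /\ forall z, A z -> enorm (y - x) <= enorm (z - x)].

(* The supremum is a maximum, the set being finite and nonempty. *)
Definition grid_extension (R : realType) (n : nat) (A : set 'rV[R]_n)
    (U : 'rV[R]_n -> R) (x : 'rV[R]_n) : R :=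
  sup [set U y | y in nearest A x].

(* Main.v *)
Require Import Defs.
From HB Require Import structures.
From mathcomp Require Import all_boot all_order all_algebra.
From mathcomp Require Import all_classical all_reals all_analysis.
From mathcomp Require Import ring lra.
Import Order.TTheory GRing.Theory Num.Theory.
Import numFieldNormedType.Exports.
Local Open Scope classical_set_scope.
Local Open Scope ring_scope.

Set Implicit Arguments.
Unset Strict Implicit.
Unset Printing Implicit Defensive.

(** The proof is the half-relaxed limit method, completed by a Perron argument
    in which the scheme itself certifies that a barrier is a super-solution.

    Everything rests on one observation ([scheme_pos_of_touching]).  If the
    lower envelope of F is positive at the jet of a smooth P at x0, then by
    consistency F^h is positive on P near x0; by monotonicity it is positive on
    any grid function W at a grid point near x0 where W - P attains its maximum
    over the grid, provided W is not much below P there.  So a solution U^h of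
    the scheme cannot be touched from above by P near x0.

    Stability ([scheme_le_strict_supersolution]).  If U^h exceeded a strict
    classical super-solution w at some grid point, the maximum of U^h - w would
    accumulate, as h -> 0, at a point where a smooth majorant of w contradicts
    the observation.  Together with the mirror statement this bounds U^h.

    Half-relaxed limits ([upper_limit_subsolution]).  The upper limit of U^h(z)
    as h -> 0 and z -> x is then a sub-solution, and the lower limit a
    super-solution.  Comparison makes them equal in Om, to a function u; the
    convergence of the piecewise constant extensions follows at once.

    Existence ([usc_ext_subsolution]).  A viscosity solution is judged on the
    closure of Om through the envelopes of its restriction to Om, and at a
    boundary point the upper envelope of u may lie strictly below the upper limit
    of U^h, so the previous step does not show that it is a sub-solution there.
    Suppose that it is not, at x0, with a smooth test function P touching it from
    above.  Let v be the lower limit.  The minimum of v and P - delta is still a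
    super-solution: where P - delta is touched from below by a test function Q,
    the scheme is positive on P, hence on Q, hence the upper envelope of F at Q is
    nonnegative ([scheme_supersolution_of_pos]).  This argument makes no
    distinction between interior and boundary points.  Comparison now gives
    u <= P - delta in Om, which is false near x0.

    Consistency speaks of smooth functions, and test functions are only C^2; the
    bridge is [quartic_majorant], which replaces a C^2 test function by a
    polynomial of degree four with almost the same jet, touching strictly and on
    the whole closure.  The mirror statements come from the change of unknown
    u -> - u, which sends F to [dual_operator F] and F^h to [dual_scheme Fh]. *)

(** * Mean value estimates and the algebra of C^k functions *)

Lemma is_derive_line (R : realType) (n : nat) (f : 'rV[R]_n -> R)
    (x v : 'rV[R]_n) :
  (forall y, derivable f y v) ->
  forall t : R, is_derive t 1 (fun s : R => f (x + s *: v)) ('D_v f (x + t *: v)).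
Proof.
move=> df t; have := df (x + t *: v); rewrite /derivable /derive.
have -> : (fun h : R => h^-1 *: ((f \o shift (x + t *: v)) (h *: v) - f (x + t *: v))) =
          (fun h : R => h^-1 *: (((fun s : R => f (x + s *: v)) \o shift t) (h *: 1) -
             f (x + t *: v))).
  apply/funext => h /=; congr (_ *: (f _ - _)).
  by rewrite [h *: 1]mulr1 scalerDl addrCA.
by move=> cv; split.
Qed.

Lemma mvt_line (R : realType) (n : nat) (f : 'rV[R]_n -> R) (x v : 'rV[R]_n) :
  (forall y, derivable f y v) ->
  forall s : R, exists2 c : R, `|c| <= `|s| &
    f (x + s *: v) - f x = s * 'D_v f (x + c *: v).
Proof.
move=> df s; pose g := fun s : R => f (x + s *: v).
have dg (t : R) : is_derive t 1 g ('D_v f (x + t *: v)) by exact: is_derive_line.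
have cg : continuous g.
  move=> t; apply: differentiable_continuous.
  by apply/derivable1_diffP; case: (dg t).
have g0 : g 0 = f x by rewrite /g scale0r addr0.
have cw (A : set R) : {within A, continuous g} by exact: continuous_subspaceT.
have [s0|/ltW s0] := leP 0 s.
- have [c] := MVT_segment s0 (fun t _ => dg t) (cw _).
  rewrite in_itv /= => /andP[c0 cs]; rewrite g0 subr0 mulrC => e.
  by exists c; rewrite ?ger0_norm.
- have [c] := MVT_segment s0 (fun t _ => dg t) (cw _).
  rewrite in_itv /= => /andP[c0 cs]; rewrite g0 sub0r => e.
  exists c; first by rewrite !ler0_norm ?lerN2.
  by rewrite -/(g s); move: e; set D := 'D_v f _ => e; lra.
Qed.

Lemma coord_le_norm (R : realType) (n : nat) (x : 'rV[R]_n) (i : 'I_n) :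
  `|x 0 i| <= `|x|.
Proof.
rewrite [leRHS]/Num.norm /= mx_normrE.
by apply/bigmax_geP; right; exists (0, i).
Qed.

Lemma norm_le_coord (R : realType) (n : nat) (x : 'rV[R]_n) (a : R) :
  0 <= a -> (forall i, `|x 0 i| <= a) -> `|x| <= a.
Proof.
move=> a0 xa; rewrite [leLHS]/Num.norm /= mx_normrE.
by apply/bigmax_leP; split=> // -[i j] _ /=; rewrite (ord1 i).
Qed.

Lemma norm_delta_le1 (R : realType) (n : nat) (i : 'I_n) :
  `|delta_mx 0 i : 'rV[R]_n| <= 1.
Proof.
apply: norm_le_coord => // j; rewrite mxE eqxx /=.
by case: eqP => _; rewrite ?normr1 ?normr0.
Qed.

(** The mean value theorem is used one coordinate at a time, along a path parallel
    to the axes.  This needs only the partial derivatives, not the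
    differentiability of f, and the path stays in the ball because the norm is the
    sup norm.  The price is the factor n. *)
Lemma lipschitz_of_partials (R : realType) (n : nat) (f : 'rV[R]_n -> R)
    (x0 : 'rV[R]_n) (rho L : R) :
  0 <= L ->
  (forall (i : 'I_n) x, derivable f x (delta_mx 0 i)) ->
  (forall (i : 'I_n) x, `|x - x0| <= rho -> `|partial i f x| <= L) ->
  forall x, `|x - x0| <= rho -> `|f x - f x0| <= n%:R * L * `|x - x0|.
Proof.
move=> L0 df bf x xr.
(* The vertices of the path from x0 to x. *)
pose y k : 'rV[R]_n := \row_j (if (j < k)%N then x 0 j else x0 0 j).
suff H k : (k <= n)%N -> `|f (y k) - f x0| <= k%:R * L * `|x - x0|.
  have -> : x = y n by apply/rowP => j; rewrite mxE ltn_ord.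
  rewrite (le_trans (H n _))//; apply: ler_wpM2l; first by rewrite mulr_ge0.
  by rewrite (_ : y n = x)//; apply/rowP => j; rewrite mxE ltn_ord.
elim: k => [_|k IH kn].
  rewrite (_ : y 0%N = x0) ?subrr ?normr0 ?mul0r//.
  by apply/rowP => j; rewrite mxE ltn0.
pose i := Ordinal kn.
have yS : y k.+1 = y k + (x 0 i - x0 0 i) *: delta_mx 0 i.
  apply/rowP => j; rewrite !mxE eqxx /= ltnS leq_eqVlt.
  have [ji|ji] := eqVneq j i.
    by rewrite ji eqxx ltnn mulr1 addrC subrK.
  rewrite mulr0 addr0 (_ : (nat_of_ord j == k) = false) //.
  by apply/negbTE; apply: contra ji => /eqP e; apply/eqP/val_inj.
have [c cs e] := mvt_line (y k) (df i) (x 0 i - x0 0 i).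
have vi : `|x 0 i - x0 0 i| <= `|x - x0|.
  by have := coord_le_norm (x - x0) i; rewrite !mxE.
have step : `|f (y k.+1) - f (y k)| <= L * `|x - x0|.
  rewrite yS e normrM mulrC ler_pM //.
  apply: (bf i); apply: norm_le_coord; first exact: le_trans xr.
  move=> j; rewrite !mxE eqxx /=; have [ji|ji] := eqVneq j i.
    rewrite ji /= ltnn mulr1 addrAC subrr add0r.
    exact: le_trans cs (le_trans vi xr).
  rewrite mulr0 addr0; case: ifP => _.
    by have := coord_le_norm (x - x0) j; rewrite !mxE => /le_trans; apply.
  by rewrite subrr normr0 (le_trans _ xr).
have {}IH := IH (ltnW kn).
have -> : f (y k.+1) - f x0 = (f (y k) - f x0) + (f (y k.+1) - f (y k)) by ring.
rewrite (le_trans (ler_normD _ _))// -(natr1 k).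
by rewrite [X in _ <= X](_ : _ = k%:R * L * `|x - x0| + L * `|x - x0|) ?lerD //; ring.
Qed.

Lemma Ck_continuous (R : realType) (n k : nat) (f : 'rV[R]_n -> R) :
  Ck k f -> continuous f.
Proof. by case: k => [|k] []. Qed.

Lemma CkW (R : realType) (n k : nat) (f : 'rV[R]_n -> R) : Ck k.+1 f -> Ck k f.
Proof.
elim: k f => [|k IH] f [cf df]; first by split.
by split=> // i; have [dfi /IH ?] := df i.
Qed.

Lemma partial_cst (R : realType) (n : nat) (c : R) (i : 'I_n) :
  partial i (cst c) = cst 0.
Proof. by apply/funext => x; rewrite /partial derive_cst. Qed.

Lemma Ck_cst (R : realType) (n k : nat) (c : R) : Ck k (cst c : 'rV[R]_n -> R).
Proof.
elim: k c => [|k IH] c; first by split=> //; exact: cst_continuous.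
split=> [|i]; first exact: cst_continuous.
split=> [x|]; first exact: derivable_cst.
by rewrite partial_cst.
Qed.

Lemma partialD (R : realType) (n : nat) (f g : 'rV[R]_n -> R) (i : 'I_n) :
  (forall x, derivable f x (delta_mx 0 i)) ->
  (forall x, derivable g x (delta_mx 0 i)) ->
  partial i (f + g) = partial i f + partial i g.
Proof. by move=> df dg; apply/funext => x; exact: deriveD. Qed.

Lemma CkD (R : realType) (n k : nat) (f g : 'rV[R]_n -> R) :
  Ck k f -> Ck k g -> Ck k (f + g).
Proof.
elim: k f g => [|k IH] f g [cf df] [cg dg].
  by split=> // x; apply: continuousD; [exact: cf|exact: cg].
split=> [x|i]; first by apply: continuousD; [exact: cf|exact: cg].
have [dfi Cf] := df i; have [dgi Cg] := dg i.
split=> [x|]; first exact: derivableD.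
by rewrite partialD //; exact: IH.
Qed.

Lemma partialM (R : realType) (n : nat) (f g : 'rV[R]_n -> R) (i : 'I_n) :
  (forall x, derivable f x (delta_mx 0 i)) ->
  (forall x, derivable g x (delta_mx 0 i)) ->
  partial i (f * g) = f * partial i g + g * partial i f.
Proof. by move=> df dg; apply/funext => x; exact: deriveM. Qed.

Lemma CkM (R : realType) (n k : nat) (f g : 'rV[R]_n -> R) :
  Ck k f -> Ck k g -> Ck k (f * g).
Proof.
elim: k f g => [|k IH] f g.
  by case=> cf _ [cg _]; split=> // x; apply: continuousM; [exact: cf|exact: cg].
move=> Cf Cg; have Cf' := CkW Cf; have Cg' := CkW Cg.
case: Cf Cg => cf df [cg dg].
split=> [x|i]; first by apply: continuousM; [exact: cf|exact: cg].
have [dfi Dfi] := df i; have [dgi Dgi] := dg i.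
split=> [x|]; first exact: derivableM.
by rewrite partialM //; apply: CkD; exact: IH.
Qed.

Lemma partialN (R : realType) (n : nat) (f : 'rV[R]_n -> R) (i : 'I_n) :
  (forall x, derivable f x (delta_mx 0 i)) -> partial i (- f) = - partial i f.
Proof. by move=> df; apply/funext => x; exact: deriveN. Qed.

Lemma CkN (R : realType) (n k : nat) (f : 'rV[R]_n -> R) : Ck k f -> Ck k (- f).
Proof.
elim: k f => [|k IH] f [cf df].
  by split=> // x; apply: continuousN; exact: cf.
split=> [x|i]; first by apply: continuousN; exact: cf.
have [dfi Cf] := df i.
split=> [x|]; first exact: derivableN.
by rewrite partialN //; exact: IH.
Qed.

Lemma Ck_sum (R : realType) (n k : nat) (I : Type) (r : seq I)
    (f : I -> 'rV[R]_n -> R) :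
  (forall i, Ck k (f i)) -> Ck k (\sum_(i <- r) f i).
Proof.
by move=> Cf; elim/big_ind : _ => //; [exact: Ck_cst | exact: CkD].
Qed.

(** * Symmetry of the Hessian and the second order remainder *)

Lemma near_continuous_dist (R : realType) (n : nat) (f : 'rV[R]_n -> R)
    (x : 'rV[R]_n) (e : R) :
  continuous f -> 0 < e -> \forall y \near x, `|f y - f x| < e.
Proof.
move=> cf e0; have /cvgrPdist_lt/(_ e e0) := cf x.
by apply: filterS => y; rewrite distrC.
Qed.

Lemma near_normP (R : realType) (n : nat) (x : 'rV[R]_n) (P : 'rV[R]_n -> Prop) :
  (\forall y \near x, P y) <-> exists2 r : R, 0 < r & forall y, `|y - x| < r -> P y.
Proof.
split=> [/nbhs_normP[r /= r0 rP]|[r r0 rP]].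
  by exists r => // y yr; apply: rP; rewrite /ball_ /= distrC.
by apply/nbhs_normP; exists r => //= y; rewrite /ball_ /= distrC; exact: rP.
Qed.

Lemma is_derive_translate (R : realType) (n : nat) (f : 'rV[R]_n -> R)
    (w x v : 'rV[R]_n) :
  derivable f (x + w) v ->
  is_derive x v (fun y => f (y + w)) ('D_v f (x + w)).
Proof.
rewrite /derivable /derive.
have -> : (fun h : R => h^-1 *: ((f \o shift (x + w)) (h *: v) - f (x + w))) =
          (fun h : R => h^-1 *: (((fun y => f (y + w)) \o shift x) (h *: v) -
             f (x + w))).
  by apply/funext => h /=; rewrite addrA.
by move=> cv; split.
Qed.

(** Two applications of the mean value theorem, first along e_j to
    f(. + s e_i) - f, then along e_i to the j-th partial derivative. *)
Lemma double_difference (R : realType) (n : nat) (f : 'rV[R]_n -> R)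
    (x : 'rV[R]_n) (i j : 'I_n) (s : R) :
  Ck 2 f ->
  exists2 c : 'rV[R]_n, `|c - x| <= `|s| + `|s| &
    f (x + s *: delta_mx 0 j + s *: delta_mx 0 i) -
    f (x + s *: delta_mx 0 j) - (f (x + s *: delta_mx 0 i) - f x) =
    s * (s * partial i (partial j f) c).
Proof.
move=> [_ /(_ j)[dj [_ /(_ i)[dij _]]]].
pose ei : 'rV[R]_n := delta_mx 0 i; pose ej : 'rV[R]_n := delta_mx 0 j.
pose g y := f (y + s *: ei) - f y.
have dg y : is_derive y ej g (partial j f (y + s *: ei) - partial j f y).
  apply: is_deriveB; [exact: is_derive_translate | exact/derivableP].
have [c cs e] := mvt_line x (fun y => @ex_derive _ _ _ _ _ _ _ (dg y)) s.
have [d ds e'] := mvt_line (x + c *: ej) dij s.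
exists (x + c *: ej + d *: ei).
  rewrite -[x + _ + _]addrA [x + _]addrC addrK (le_trans (ler_normD _ _)) //.
  have H (t : R) k : `|t| <= `|s| -> `|t *: (delta_mx 0 k : 'rV[R]_n)| <= `|s|.
    by move=> ts; rewrite normrZ -[leRHS]mulr1 ler_pM // norm_delta_le1.
  by rewrite lerD // H.
rewrite -[X in s * X]e' -/ei -/ej.
have := derive_val (is_derive := dg (x + c *: ej)) => <-.
by rewrite -e.
Qed.

Lemma dist_le_split (R : realType) (p q r e : R) :
  `|p - q| < e / 2 -> `|p - r| < e / 2 -> `|q - r| <= e.
Proof.
move=> pq pr; rewrite (splitr e); apply: le_trans (ler_distD p _ _) _.
by rewrite distrC lerD // ltW.
Qed.

(** The double difference of f along e_i and e_j does not depend on the order of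
    the two directions, so the two mixed derivatives agree at a pair of points
    that tend to x.  Symmetry is essential here: the envelopes of F are taken over
    symmetric matrices only. *)
Lemma hess_sym (R : realType) (n : nat) (f : 'rV[R]_n -> R) (x : 'rV[R]_n) :
  Ck 2 f -> symmx (hess f x).
Proof.
move=> Cf; apply/matrixP => j i; rewrite !mxE.
apply/eqP; rewrite -subr_eq0 -normr_le0; apply/ler_addgt0Pl => e e0.
have e2 : 0 < e / 2 by rewrite divr_gt0.
have cont k l : continuous (partial k (partial l f)).
  by case: Cf => _ /(_ l)[_ [_ /(_ k)[_ []]]].
have /near_normP[r r0 rP] :
    \forall y \near x, `|partial i (partial j f) y - partial i (partial j f) x| < e / 2
      /\ `|partial j (partial i f) y - partial j (partial i f) x| < e / 2.
  by apply: filterI; apply: near_continuous_dist.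
pose s := r / 4; have s0 : 0 < s by rewrite divr_gt0.
have ssr : `|s| + `|s| < r by rewrite gtr0_norm // /s; lra.
have [a ax ea] := double_difference x i j s Cf.
have [b bx eb] := double_difference x j i s Cf.
have eab : partial i (partial j f) a = partial j (partial i f) b.
  have s0' : s != 0 by rewrite gt_eqF.
  move: ea eb; move: (partial i _ a) (partial j _ b) => A B.
  move: (s *: _) (s *: _) => vj vi; rewrite [x + vi + vj]addrAC.
  move: (f (x + vj + vi)) (f (x + vi)) (f (x + vj)) => p q r' ea eb.
  by apply: (mulfI s0'); apply: (mulfI s0'); rewrite -ea -eb; ring.
have [Ha _] := rP a (le_lt_trans ax ssr).
have [_ Hb] := rP b (le_lt_trans bx ssr).
rewrite addr0; apply: dist_le_split Ha _; rewrite eab; exact: Hb.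
Qed.

(** [lipschitz_of_partials] is applied twice, to the first order partial
    derivatives and then to f; this avoids the chain rule along segments. *)
Lemma taylor2_remainder (R : realType) (n : nat) (f : 'rV[R]_n -> R)
    (x0 : 'rV[R]_n) (eta : R) :
  Ck 2 f -> f x0 = 0 -> grad f x0 = 0 -> hess f x0 = 0 -> 0 < eta ->
  \forall x \near x0, `|f x| <= eta * `|x - x0| ^+ 2.
Proof.
move=> Cf f0 g0 h0 eta0.
(* Each use of the Lipschitz bound costs a factor n; adding 1 keeps the divisor
   positive when n = 0. *)
pose et := eta / (n%:R * n%:R + 1).
have nn : (0 : R) < n%:R * n%:R + 1 by rewrite ltr_wpDl ?mulr_ge0.
have et0 : 0 < et by rewrite divr_gt0.
have : \forall x \near x0, forall i j, `|partial i (partial j f) x| < et.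
  suff H i j : \forall x \near x0, `|partial i (partial j f) x| < et.
    have H' i : \forall x \near x0, forall j, `|partial i (partial j f) x| < et.
      exact: (@filter_forall _ _ (fun j x => `|partial i (partial j f) x| < et) _ _ (H i)).
    exact: (@filter_forall _ _ (fun i x => forall j, `|partial i (partial j f) x| < et) _ _ H').
  have hij : partial i (partial j f) x0 = 0.
    by move/matrixP/(_ i j): h0; rewrite !mxE.
  have cij : continuous (partial i (partial j f)).
    by case: Cf => _ /(_ j)[_ [_ /(_ i)[_ []]]].
  have := near_continuous_dist x0 cij et0; rewrite hij.
  by apply: filterS => y; rewrite subr0.
move/near_normP => [r r0 rP]; apply/near_normP; exists r => // x xr.
have L1 (j : 'I_n) y : `|y - x0| <= `|x - x0| ->
    `|partial j f y| <= n%:R * et * `|x - x0|.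
  move=> yx; have gj : partial j f x0 = 0 by move/rowP/(_ j): g0; rewrite !mxE.
  have [dj [_ dij]] := Cf.2 j.
  have bij (i : 'I_n) z : `|z - x0| <= `|x - x0| -> `|partial i (partial j f) z| <= et.
    by move=> zx; apply/ltW/rP; exact: le_lt_trans xr.
  have := lipschitz_of_partials (ltW et0) (fun i => (dij i).1) bij yx.
  by rewrite gj subr0 => /le_trans -> //; rewrite ler_wpM2l ?mulr_ge0 // ltW.
have L0 : 0 <= n%:R * et * `|x - x0| by rewrite !mulr_ge0 // ltW.
have := lipschitz_of_partials L0 (fun i => (Cf.2 i).1) L1 (lexx _).
rewrite f0 subr0 => /le_trans -> //.
rewrite mulrA -mulrA -expr2 ler_wpM2r // ?sqr_ge0 // mulrA /et.
rewrite mulrA ler_pdivrMr // mulrC ler_wpM2l ?(ltW eta0) //; lra.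
Qed.

(** * Polynomials with a prescribed jet *)

Definition displacement (R : realType) (n : nat) (x0 : 'rV[R]_n) (i : 'I_n) :
    'rV[R]_n -> R :=
  fun x => x 0 i - x0 0 i.

Lemma is_derive_displacement (R : realType) (n : nat) (x0 : 'rV[R]_n)
    (i k : 'I_n) (x : 'rV[R]_n) :
  is_derive x (delta_mx 0 k) (displacement x0 i) (i == k)%:R.
Proof.
have H : (fun h : R => h^-1 *: ((displacement x0 i \o shift x) (h *: delta_mx 0 k)
            - displacement x0 i x)) @ 0^' --> ((i == k)%:R : R).
  apply: cvg_near_cst; near=> h.
  have h0 : h != 0 by near: h; exact: nbhs_dnbhs_neq.
  rewrite /displacement /= !mxE eqxx /= [X in _ *: X](_ : _ = h * (i == k)%:R); last first.
    by ring.
  by rewrite [LHS]mulKf.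
split; first by apply/cvg_ex; exists (i == k)%:R.
exact: cvg_lim.
Unshelve. all: by end_near. Qed.

Lemma partial_displacement (R : realType) (n : nat) (x0 : 'rV[R]_n) (i k : 'I_n) :
  partial k (displacement x0 i) = cst (i == k)%:R.
Proof.
by apply/funext => x; apply: derive_val; exact: is_derive_displacement.
Qed.

Lemma Ck_displacement (R : realType) (n k : nat) (x0 : 'rV[R]_n) (i : 'I_n) :
  Ck k (displacement x0 i).
Proof.
have c : continuous (displacement x0 i).
  by move=> x; apply: continuousB; [exact: coord_continuous | exact: cst_continuous].
case: k => [|k]; first by split.
split=> // l; split=> [x|].
  by apply: ex_derive; exact: is_derive_displacement.
by rewrite partial_displacement; exact: Ck_cst.
Qed.

Lemma gradE (R : realType) (n : nat) (f : 'rV[R]_n -> R) (x : 'rV[R]_n) i :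
  grad f x 0 i = partial i f x.
Proof. by rewrite mxE. Qed.

Lemma hessE (R : realType) (n : nat) (f : 'rV[R]_n -> R) (x : 'rV[R]_n) i j :
  hess f x i j = partial i (partial j f) x.
Proof. by rewrite mxE. Qed.

Lemma hess_eq (R : realType) (n : nat) (f : 'rV[R]_n -> R) (x : 'rV[R]_n)
    (X : 'M[R]_n) :
  (forall i j, partial i (partial j f) x = X i j) -> hess f x = X.
Proof. by move=> fX; apply/matrixP => i j; rewrite hessE fX. Qed.

Lemma grad_cst (R : realType) (n : nat) (c : R) (x : 'rV[R]_n) :
  grad (cst c) x = 0.
Proof. by apply/rowP => i; rewrite gradE mxE partial_cst. Qed.

Lemma hess_cst (R : realType) (n : nat) (c : R) (x : 'rV[R]_n) :
  hess (cst c) x = 0.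
Proof. by apply: hess_eq => i j; rewrite mxE !partial_cst. Qed.

Lemma gradD (R : realType) (n : nat) (f g : 'rV[R]_n -> R) (x : 'rV[R]_n) :
  Ck 2 f -> Ck 2 g -> grad (f + g) x = grad f x + grad g x.
Proof.
move=> [_ df] [_ dg]; apply/rowP => i; rewrite !mxE partialD //.
  by case: (df i).
by case: (dg i).
Qed.

Lemma hessD (R : realType) (n : nat) (f g : 'rV[R]_n -> R) (x : 'rV[R]_n) :
  Ck 2 f -> Ck 2 g -> hess (f + g) x = hess f x + hess g x.
Proof.
move=> [_ df] [_ dg]; move: (hessE f x) (hessE g x).
move: (hess f x) (hess g x) => A B HA HB; apply: hess_eq => i j.
rewrite [RHS]mxE HA HB.
have [dfj [_ /(_ i)[dfij _]]] := df j; have [dgj [_ /(_ i)[dgij _]]] := dg j.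
by rewrite (partialD dfj dgj) (partialD dfij dgij).
Qed.

Lemma gradN (R : realType) (n : nat) (f : 'rV[R]_n -> R) (x : 'rV[R]_n) :
  Ck 2 f -> grad (- f) x = - grad f x.
Proof.
by move=> [_ df]; apply/rowP => i; rewrite !mxE partialN //; case: (df i).
Qed.

Lemma hessN (R : realType) (n : nat) (f : 'rV[R]_n -> R) (x : 'rV[R]_n) :
  Ck 2 f -> hess (- f) x = - hess f x.
Proof.
move=> [_ df]; move: (hessE f x); move: (hess f x) => A HA.
apply: hess_eq => i j; rewrite [RHS]mxE HA.
have [dfj [_ /(_ i)[dfij _]]] := df j.
by rewrite (partialN dfj) (partialN dfij).
Qed.

Lemma gradM (R : realType) (n : nat) (f g : 'rV[R]_n -> R) (x : 'rV[R]_n) :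
  Ck 2 f -> Ck 2 g -> grad (f * g) x = f x *: grad g x + g x *: grad f x.
Proof.
move=> [_ df] [_ dg]; apply/rowP => i; rewrite !mxE partialM //.
  by case: (df i).
by case: (dg i).
Qed.

Lemma hessM (R : realType) (n : nat) (f g : 'rV[R]_n -> R) (x : 'rV[R]_n) :
  Ck 2 f -> Ck 2 g ->
  hess (f * g) x = f x *: hess g x + g x *: hess f x +
    ((grad f x)^T *m grad g x + (grad g x)^T *m grad f x).
Proof.
move=> [_ df] [_ dg].
move: (hessE f x) (hessE g x) (gradE f x) (gradE g x).
move: (hess f x) (hess g x) (grad f x) (grad g x) => A B p q HA HB Hp Hq.
apply: hess_eq => i j; rewrite !mxE !big_ord1 !mxE HA HB !Hp !Hq.
have [dfj [_ /(_ i)[dfij _]]] := df j; have [dgj [_ /(_ i)[dgij _]]] := dg j.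
have [dfi _] := df i; have [dgi _] := dg i.
rewrite (partialM dfj dgj) partialD; first last.
- by move=> y; apply: derivableM; [exact: dgi | exact: dfij].
- by move=> y; apply: derivableM; [exact: dfi | exact: dgij].
rewrite (partialM dfi dgij) (partialM dgi dfij).
rewrite -[LHS]/(f x * partial i (partial j g) x + partial j g x * partial i f x +
  (g x * partial i (partial j f) x + partial j f x * partial i g x)).
move: (partial i (partial j g) x) (partial i (partial j f) x) => a b.
by move: (partial i f x) (partial j g x) (partial j f x) (partial i g x) => c d e h; ring.
Qed.

Lemma grad_sum (R : realType) (n : nat) (I : Type) (r : seq I)
    (f : I -> 'rV[R]_n -> R) (x : 'rV[R]_n) :
  (forall i, Ck 2 (f i)) ->
  grad (\sum_(i <- r) f i) x = \sum_(i <- r) grad (f i) x.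
Proof.
move=> Cf; elim: r => [|i r IH]; first by rewrite !big_nil grad_cst.
by rewrite !big_cons gradD ?IH //; exact: Ck_sum.
Qed.

Lemma hess_sum (R : realType) (n : nat) (I : Type) (r : seq I)
    (f : I -> 'rV[R]_n -> R) (x : 'rV[R]_n) :
  (forall i, Ck 2 (f i)) ->
  hess (\sum_(i <- r) f i) x = \sum_(i <- r) hess (f i) x.
Proof.
move=> Cf; elim: r => [|i r IH]; first by rewrite !big_nil hess_cst.
by rewrite !big_cons hessD ?IH //; exact: Ck_sum.
Qed.

Lemma gradZ (R : realType) (n : nat) (c : R) (f : 'rV[R]_n -> R) (x : 'rV[R]_n) :
  Ck 2 f -> grad (cst c * f) x = c *: grad f x.
Proof.
move=> Cf; have := gradM x (Ck_cst n 2 c) Cf; rewrite grad_cst.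
by move: (grad f x) => p ->; rewrite scaler0 addr0.
Qed.

Lemma hessZ (R : realType) (n : nat) (c : R) (f : 'rV[R]_n -> R) (x : 'rV[R]_n) :
  Ck 2 f -> hess (cst c * f) x = c *: hess f x.
Proof.
move=> Cf; have := hessM x (Ck_cst n 2 c) Cf; rewrite grad_cst hess_cst.
move: (hess f x) (grad f x) => A p ->.
by rewrite trmx0 mul0mx mulmx0 scaler0 !addr0.
Qed.

Lemma grad_displacement (R : realType) (n : nat) (x0 : 'rV[R]_n) (i : 'I_n) x :
  grad (displacement x0 i) x = delta_mx 0 i.
Proof.
by apply/rowP => k; rewrite gradE partial_displacement mxE eqxx eq_sym.
Qed.

Lemma hess_displacement (R : realType) (n : nat) (x0 : 'rV[R]_n) (i : 'I_n) x :
  hess (displacement x0 i) x = 0.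
Proof.
by apply: hess_eq => k l; rewrite partial_displacement partial_cst mxE.
Qed.

Lemma displacement0 (R : realType) (n : nat) (x0 : 'rV[R]_n) (i : 'I_n) :
  displacement x0 i x0 = 0.
Proof. by rewrite /displacement subrr. Qed.

Lemma Ck_displacement2 (R : realType) (n k : nat) (x0 : 'rV[R]_n) (i j : 'I_n) :
  Ck k (displacement x0 i * displacement x0 j).
Proof. by apply: CkM; exact: Ck_displacement. Qed.

Lemma grad_displacement2 (R : realType) (n : nat) (x0 : 'rV[R]_n) (i j : 'I_n) :
  grad (displacement x0 i * displacement x0 j) x0 = 0.
Proof.
rewrite (gradM x0 (Ck_displacement 2 x0 i) (Ck_displacement 2 x0 j)).
by rewrite !displacement0 !scale0r addr0.
Qed.

Lemma hess_displacement2 (R : realType) (n : nat) (x0 : 'rV[R]_n) (i j : 'I_n) :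
  hess (displacement x0 i * displacement x0 j) x0 = delta_mx i j + delta_mx j i.
Proof.
rewrite (hessM x0 (Ck_displacement 2 x0 i) (Ck_displacement 2 x0 j)).
rewrite !hess_displacement !scaler0 !add0r !grad_displacement !trmx_delta.
by rewrite !mul_delta_mx.
Qed.

Definition taylor_poly (R : realType) (n : nat) (x0 : 'rV[R]_n) (c : R)
    (p : 'rV[R]_n) (X : 'M[R]_n) : 'rV[R]_n -> R :=
  cst c + \sum_i cst (p 0 i) * displacement x0 i +
  \sum_i \sum_j cst (X i j / 2) * (displacement x0 i * displacement x0 j).

Lemma Ck_taylor_poly (R : realType) (n k : nat) (x0 : 'rV[R]_n) c p X :
  Ck k (taylor_poly x0 c p X).
Proof.
apply: CkD; first apply: CkD; first exact: Ck_cst.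
- by apply: Ck_sum => i; apply: CkM; [exact: Ck_cst | exact: Ck_displacement].
- apply: Ck_sum => i; apply: Ck_sum => j.
  by apply: CkM; [exact: Ck_cst | exact: Ck_displacement2].
Qed.

(** Without the symmetry of X the Hessian would be the symmetric part of X. *)
Lemma jet_taylor_poly (R : realType) (n : nat) (x0 : 'rV[R]_n) c p X :
  [/\ taylor_poly x0 c p X x0 = c, grad (taylor_poly x0 c p X) x0 = p &
      symmx X -> hess (taylor_poly x0 c p X) x0 = X].
Proof.
pose f1 i : 'rV[R]_n -> R := cst (p 0 i) * displacement x0 i.
pose f2 i j : 'rV[R]_n -> R :=
  cst (X i j / 2) * (displacement x0 i * displacement x0 j).
have C1 i : Ck 2 (f1 i) by apply: CkM; [exact: Ck_cst | exact: Ck_displacement].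
have C2 i j : Ck 2 (f2 i j).
  by apply: CkM; [exact: Ck_cst | exact: Ck_displacement2].
have C2s i : Ck 2 (\sum_j f2 i j) := Ck_sum _ (C2 i).
have G1 i : grad (f1 i) x0 = p 0 i *: delta_mx 0 i.
  by rewrite /f1 (gradZ _ x0 (Ck_displacement 2 x0 i)) grad_displacement.
have H1 i : hess (f1 i) x0 = 0.
  by rewrite /f1 (hessZ _ x0 (Ck_displacement 2 x0 i)) hess_displacement scaler0.
have G2 i j : grad (f2 i j) x0 = 0.
  by rewrite /f2 (gradZ _ x0 (Ck_displacement2 2 x0 i j)) grad_displacement2 scaler0.
have H2 i j : hess (f2 i j) x0 = (X i j / 2) *: (delta_mx i j + delta_mx j i).
  by rewrite /f2 (hessZ _ x0 (Ck_displacement2 2 x0 i j)) hess_displacement2.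
have Cc : Ck 2 (cst c : 'rV[R]_n -> R) := Ck_cst n 2 c.
have CS1 : Ck 2 (\sum_i f1 i) := Ck_sum _ C1.
have CS2 : Ck 2 (\sum_i \sum_j f2 i j) := Ck_sum _ C2s.
rewrite /taylor_poly -/(f1 _); split.
- rewrite !fctE !fct_sumE big1 => [|i _]; last first.
    by rewrite fctE displacement0 mulr0.
  rewrite addr0 big1 ?addr0 // => i _; rewrite fct_sumE big1 // => j _.
  by rewrite !fctE displacement0 mul0r mulr0.
- rewrite (gradD x0 (CkD Cc CS1) CS2) (gradD x0 Cc CS1) grad_cst add0r.
  rewrite (grad_sum _ x0 C1) (grad_sum _ x0 C2s).
  rewrite [X in _ + X]big1 => [|i _]; last first.
    by rewrite (grad_sum _ x0 (C2 i)) big1.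
  by rewrite addr0 [RHS]row_sum_delta; apply: eq_bigr => i _; rewrite G1.
- move=> sX.
  rewrite (hessD x0 (CkD Cc CS1) CS2) (hessD x0 Cc CS1) hess_cst add0r.
  rewrite (hess_sum _ x0 C1) (hess_sum _ x0 C2s).
  rewrite [X in X + _]big1 => [|i _]; last by rewrite H1.
  rewrite add0r (eq_bigr (fun i => \sum_j (X i j / 2) *: delta_mx i j +
    \sum_j (X i j / 2) *: delta_mx j i)); last first.
    move=> i _; rewrite (hess_sum _ x0 (C2 i)) -big_split /=.
    by apply: eq_bigr => j _; rewrite H2 scalerDr.
  rewrite big_split /= [X in _ + X]exchange_big /=.
  have E : X = \sum_i \sum_j (X i j / 2) *: delta_mx i j +
               \sum_i \sum_j (X i j / 2) *: delta_mx i j.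
    rewrite -big_split /= {1}[X]matrix_sum_delta; apply: eq_bigr => i _.
    rewrite -big_split /=; apply: eq_bigr => j _.
    by rewrite -scalerDl; congr (_ *: _); field.
  rewrite [RHS]E; congr (_ + _); apply: eq_bigr => i _; apply: eq_bigr => j _.
  by rewrite -{1}sX mxE.
Qed.

(** The squared Euclidean distance to x0, which is smooth, whereas the norm of
    ['rV[R]_n] is the sup norm. *)
Definition sqdist (R : realType) (n : nat) (x0 : 'rV[R]_n) : 'rV[R]_n -> R :=
  \sum_i displacement x0 i * displacement x0 i.

Lemma Ck_sqdist (R : realType) (n k : nat) (x0 : 'rV[R]_n) : Ck k (sqdist x0).
Proof. by apply: Ck_sum => i; exact: Ck_displacement2. Qed.

Lemma jet_sqdist (R : realType) (n : nat) (x0 : 'rV[R]_n) :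
  [/\ sqdist x0 x0 = 0, grad (sqdist x0) x0 = 0 & hess (sqdist x0) x0 = 2%:M].
Proof.
have C i : Ck 2 (displacement x0 i * displacement x0 i).
  exact: Ck_displacement2.
split.
- by rewrite /sqdist fct_sumE big1 // => i _; rewrite fctE displacement0 mul0r.
- by rewrite (grad_sum _ x0 C) big1 // => i _; rewrite grad_displacement2.
- rewrite (hess_sum _ x0 C); under eq_bigr do rewrite hess_displacement2.
  rewrite big_split /= -mx1_sum_delta; apply/matrixP => i j; rewrite !mxE.
  by case: eqP => _; rewrite ?addr0 //; ring.
Qed.

Lemma sqr_norm_le_sqdist (R : realType) (n : nat) (x0 x : 'rV[R]_n) :
  `|x - x0| ^+ 2 <= sqdist x0 x.
Proof.
have E : sqdist x0 x = \sum_i (x 0 i - x0 0 i) ^+ 2.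
  by rewrite /sqdist fct_sumE; apply: eq_bigr => i _; rewrite expr2.
have S0 : 0 <= sqdist x0 x by rewrite E sumr_ge0 // => i _; exact: sqr_ge0.
rewrite -(sqr_sqrtr S0) ler_pXn2r ?nnegrE ?sqrtr_ge0 //.
apply: norm_le_coord => [|i]; first exact: sqrtr_ge0.
rewrite -sqrtr_sqr ler_wsqrtr // E (bigD1 i) //= !mxE lerDl.
by rewrite sumr_ge0 // => j _; exact: sqr_ge0.
Qed.

(** * Replacing a C^2 test function by a polynomial *)

Lemma compact_continuous_bounded (R : realType) (n : nat) (A : set 'rV[R]_n)
    (f : 'rV[R]_n -> R) :
  compact A -> continuous f -> exists M : R, forall x, A x -> `|f x| <= M.
Proof.
move=> cA cf.
have /compact_bounded[M [_ /(_ (M + 1)) bM]] : compact (f @` A).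
  by apply: continuous_compact => //; exact: continuous_subspaceT.
by exists (M + 1) => x Ax; apply: bM; [rewrite ltrDl | exists x].
Qed.

(** The fourth order term K S^2 does not affect the jet at x0, yet with K large it
    makes up for whatever T lacks away from x0. *)
Lemma quartic_penalty (R : realType) (n : nat) (A : set 'rV[R]_n)
    (u T S : 'rV[R]_n -> R) (x0 : 'rV[R]_n) (M C e r : R) :
  0 < e -> 0 < r -> (forall x, A x -> u x <= M) ->
  (forall x, A x -> `|T x| <= C) -> (forall x, `|x - x0| ^+ 2 <= S x) ->
  (forall x, `|x - x0| < r -> A x -> u x <= T x + e / 4 * `|x - x0| ^+ 2) ->
  exists K : R, forall x, A x ->
    u x + e / 4 * `|x - x0| ^+ 2 <= T x + (e / 2 * S x + K * (S x * S x)).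
Proof.
move=> e0 r0 uM TC dS near_max.
(* Outside the ball S^2 >= r^4, so K S^2 exceeds the gap between u and T. *)
pose K := (`|M| + `|C|) / r ^+ 4; exists K => x Ax.
have K0 : 0 <= K by rewrite divr_ge0 ?addr_ge0 // exprn_ge0 // ltW.
have Sd := dS x; have d0 : 0 <= `|x - x0| ^+ 2 by exact: sqr_ge0.
have Sx0 : 0 <= S x by exact: le_trans d0 Sd.
have eS : e * `|x - x0| ^+ 2 <= e * S x by rewrite ler_wpM2l // ltW.
have ed0 : 0 <= e * `|x - x0| ^+ 2 by rewrite mulr_ge0 // ltW.
have [xr|rx] := ltP `|x - x0| r.
  have : 0 <= K * (S x * S x) := mulr_ge0 K0 (mulr_ge0 Sx0 Sx0).
  move: (near_max x xr Ax) eS ed0.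
  by move: (T x) (S x) (u x) (`|x - x0| ^+ 2) (K * _) => *; lra.
have rS : r ^+ 2 <= S x.
  by apply: le_trans Sd; rewrite !expr2 ler_pM // ltW.
have KS : `|M| + `|C| <= K * (S x * S x).
  rewrite /K mulrAC ler_pdivlMr ?exprn_gt0 // ler_wpM2l ?addr_ge0 //.
  have -> : r ^+ 4 = r ^+ 2 * r ^+ 2 by ring.
  by rewrite ler_pM // sqr_ge0.
have := uM x Ax; have := ler_norm M; have := ler_norm C.
have := ler_normlW (_ : `|- T x| <= C); rewrite normrN => /(_ (TC x Ax)).
move: KS eS ed0.
by move: (T x) (S x) (u x) (`|x - x0| ^+ 2) (K * _) `|M| `|C| => *; lra.
Qed.

(** A C^2 test function touching u from above can be replaced by a polynomial that
    touches u strictly, and on the whole of A rather than locally.  The Hessian has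
    to grow by e, which absorbs the second order remainder of phi;
    [lower_env_add_scalar] compensates for this on the side of the operator. *)
Lemma quartic_majorant (R : realType) (n : nat) (A : set 'rV[R]_n)
    (u phi : 'rV[R]_n -> R) (M : R) (x0 : 'rV[R]_n) (e : R) :
  compact A -> (forall x, A x -> u x <= M) -> Ck 2 phi ->
  local_max_on A (u \- phi) x0 -> 0 < e ->
  exists2 P : 'rV[R]_n -> R, smooth P &
    [/\ P x0 = u x0, grad P x0 = grad phi x0, hess P x0 = hess phi x0 + e%:M &
        exists2 eps : R, 0 < eps &
          forall x, A x -> u x + eps * `|x - x0| ^+ 2 <= P x].
Proof.
move=> cA uM Cphi lmax e0.
pose T := taylor_poly x0 (u x0) (grad phi x0) (hess phi x0).
have CT k : Ck k T := Ck_taylor_poly k x0 _ _ _.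
have [T0 gT hT] := jet_taylor_poly x0 (u x0) (grad phi x0) (hess phi x0).
have {}hT := hT (hess_sym x0 Cphi).
pose f := phi + - T + cst (u x0 - phi x0).
have Cf : Ck 2 f := CkD (CkD Cphi (CkN (CT 2))) (Ck_cst n 2 (u x0 - phi x0)).
have f0 : f x0 = 0.
  rewrite -[f x0]/(phi x0 - T x0 + (u x0 - phi x0)) [T x0]T0.
  by rewrite addrC addrA subrK subrr.
have gf : grad f x0 = 0.
  rewrite /f (gradD x0 (CkD Cphi (CkN (CT 2))) (Ck_cst n 2 (u x0 - phi x0))).
  rewrite (gradD x0 Cphi (CkN (CT 2))) (gradN x0 (CT 2)) [grad T x0]gT grad_cst.
  by rewrite subrr addr0.
have hf : hess f x0 = 0.
  rewrite /f (hessD x0 (CkD Cphi (CkN (CT 2))) (Ck_cst n 2 (u x0 - phi x0))).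
  rewrite (hessD x0 Cphi (CkN (CT 2))) (hessN x0 (CT 2)) [hess T x0]hT hess_cst.
  by rewrite subrr addr0.
have e4 : 0 < e / 4 by rewrite divr_gt0.
have [r r0 near_max] : exists2 r : R, 0 < r & forall x, `|x - x0| < r ->
    A x -> u x <= T x + e / 4 * `|x - x0| ^+ 2.
  apply/near_normP; have := taylor2_remainder Cf f0 gf hf e4.
  move: lmax; rewrite /local_max_on near_withinE; apply: filterS2 => x + fx Ax.
  move=> /(_ Ax); move: fx.
  rewrite -[f x]/(phi x - T x + (u x0 - phi x0)) /= => /ler_normlW.
  by move: (phi x) (T x) (u x) (phi x0) (u x0) (e / 4 * _) => *; lra.
have [C TC] := compact_continuous_bounded cA (Ck_continuous (CT 0)).
pose S := sqdist x0; have CS k : Ck k S := Ck_sqdist k x0.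
have [S0 gS hS] := jet_sqdist x0.
have [K uP] := quartic_penalty e0 r0 uM TC (sqr_norm_le_sqdist x0) near_max.
pose P := T + (cst (e / 2) * S + cst K * (S * S)).
exists P => [k|].
  apply: CkD (CT k) _; apply: CkD (CkM (Ck_cst n k _) (CS k)) _.
  exact: CkM (Ck_cst n k _) (CkM (CS k) (CS k)).
have C1 : Ck 2 (cst (e / 2) * S) := CkM (Ck_cst n 2 _) (CS 2).
have C2 : Ck 2 (cst K * (S * S)) := CkM (Ck_cst n 2 _) (CkM (CS 2) (CS 2)).
have gSS : grad (S * S) x0 = 0.
  by rewrite (gradM x0 (CS 2) (CS 2)) [S x0]S0 !scale0r addr0.
have hSS : hess (S * S) x0 = 0.
  rewrite (hessM x0 (CS 2) (CS 2)) [S x0]S0 [grad S x0]gS !scale0r.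
  by rewrite mulmx0 !addr0.
split.
- rewrite -[P x0]/(T x0 + (e / 2 * S x0 + K * (S x0 * S x0))) [T x0]T0 [S x0]S0.
  by rewrite !mulr0 !addr0.
- rewrite (gradD x0 (CT 2) (CkD C1 C2)) (gradD x0 C1 C2).
  rewrite (gradZ _ x0 (CS 2)) (gradZ _ x0 (CkM (CS 2) (CS 2))).
  by rewrite gSS [grad S x0]gS [grad T x0]gT !scaler0 !addr0.
- rewrite (hessD x0 (CT 2) (CkD C1 C2)) (hessD x0 C1 C2).
  rewrite (hessZ _ x0 (CS 2)) (hessZ _ x0 (CkM (CS 2) (CS 2))).
  rewrite hSS [hess S x0]hS [hess T x0]hT scaler0 addr0 scale_scalar_mx.
  by rewrite divfK.
by exists (e / 4); [exact: e4 | exact: uP].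
Qed.

(** * Limits superior and inferior along a filter *)

Lemma limf_einf_gt (R : realType) (T : choiceType) (X : filteredType T)
    (f : X -> R) (F : set_system X)
    (a : \bar R) : Filter F ->
  (a < limf_einf (fun x => (f x)%:E) F)%E -> \forall x \near F, (a < (f x)%:E)%E.
Proof.
move=> FF; rewrite limf_einfE => /ereal_sup_gt[_ [V FV <-] aV].
apply: filterS FV => x Vx; apply: lt_le_trans aV _.
by apply: ereal_inf_lbound; exists x.
Qed.

Lemma limf_einf_ge (R : realType) (T : choiceType) (X : filteredType T)
    (f : X -> R) (F : set_system X)
    (a : R) :
  (\forall x \near F, a <= f x) -> (a%:E <= limf_einf (fun x => (f x)%:E) F)%E.
Proof.
move=> Fa; rewrite limf_einfE.
apply: le_trans (ereal_sup_ubound _); last by exists [set x | a <= f x].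
by apply: le_ereal_inf_tmp => _ [x /= ax <-]; rewrite lee_fin.
Qed.

Lemma limf_esup_lt (R : realType) (T : choiceType) (X : filteredType T)
    (f : X -> R) (F : set_system X)
    (a : \bar R) : Filter F ->
  (limf_esup (fun x => (f x)%:E) F < a)%E -> \forall x \near F, ((f x)%:E < a)%E.
Proof.
move=> FF; rewrite limf_esupE => /ereal_inf_lt[_ [V FV <-] aV].
apply: filterS FV => x Vx; apply: le_lt_trans _ aV.
by apply: ereal_sup_ubound; exists x.
Qed.

Lemma limf_esup_le (R : realType) (T : choiceType) (X : filteredType T)
    (f : X -> R) (F : set_system X)
    (a : R) :
  (\forall x \near F, f x <= a) -> (limf_esup (fun x => (f x)%:E) F <= a%:E)%E.
Proof.
move=> Fa; rewrite limf_esupE.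
apply: le_trans (ereal_inf_lbound _) _; first by exists [set x | f x <= a].
by apply: ge_ereal_sup => _ [x /= ax <-]; rewrite lee_fin.
Qed.

Lemma limf_esup_ge (R : realType) (T : choiceType) (X : filteredType T)
    (f : X -> R) (F : set_system X)
    (a : R) : ProperFilter F ->
  (\forall x \near F, a <= f x) -> (a%:E <= limf_esup (fun x => (f x)%:E) F)%E.
Proof.
move=> FF Fa; rewrite leNgt; apply/negP => /limf_esup_lt Flt.
by have [x [/= ax]] := filter_ex (filterI Fa Flt); rewrite lte_fin ltNge ax.
Qed.

Lemma gt0_ereal_real (R : realType) (l : \bar R) :
  (0 < l)%E -> exists2 c : R, 0 < c & (c%:E < l)%E.
Proof.
case: l => [r| |] //; rewrite ?lte_fin => r0.
  by exists (r / 2); rewrite ?lte_fin; lra.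
by exists 1; rewrite ?ltry.
Qed.

Lemma limf_einf_gt0 (R : realType) (T : choiceType) (X : filteredType T)
    (f : X -> R) (F : set_system X) :
  Filter F -> (0 < limf_einf (fun x => (f x)%:E) F)%E ->
  exists2 c : R, 0 < c & \forall x \near F, c < f x.
Proof.
move=> FF /gt0_ereal_real[c c0 /limf_einf_gt cf].
by exists c.
Qed.

Section real_limsup.
Context (R : realType) (T : choiceType) (X : filteredType T)
    (f : X -> R) (F : set_system X) (M : R).
Context {FF : ProperFilter F}.
Hypothesis fM : \forall x \near F, `|f x| <= M.

Let limsup := fine (limf_esup (fun x => (f x)%:E) F).

Lemma EFin_limsup : limsup%:E = limf_esup (fun x => (f x)%:E) F.
Proof.
apply: fineK; rewrite fin_numElt; apply/andP; split.
  apply: lt_le_trans (ltNyr (- M)) _; apply: limf_esup_ge.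
  by apply: filterS fM => x; rewrite ler_norml => /andP[].
apply: le_lt_trans _ (ltry M); apply: limf_esup_le.
by apply: filterS fM => x; rewrite ler_norml => /andP[].
Qed.

Lemma limsup_lt (a : R) : limsup < a -> \forall x \near F, f x < a.
Proof.
rewrite -lte_fin EFin_limsup => /limf_esup_lt.
by apply: filterS => x; rewrite lte_fin.
Qed.

Lemma limsup_le (a : R) : (\forall x \near F, f x <= a) -> limsup <= a.
Proof. by move=> Fa; rewrite -lee_fin EFin_limsup; exact: limf_esup_le. Qed.

Lemma limsup_ge (a : R) : (\forall x \near F, a <= f x) -> a <= limsup.
Proof. by move=> Fa; rewrite -lee_fin EFin_limsup; exact: limf_esup_ge. Qed.

Lemma normr_limsup : `|limsup| <= M.
Proof.
rewrite ler_norml; apply/andP; split; [apply: limsup_ge|apply: limsup_le].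
  by apply: filterS fM => x; rewrite ler_norml => /andP[].
by apply: filterS fM => x; rewrite ler_norml => /andP[].
Qed.

Lemma limsup_gt_ex (a : R) (Q : X -> Prop) :
  a < limsup -> (\forall x \near F, Q x) -> exists2 x, Q x & a < f x.
Proof.
move=> al FQ; apply: contrapT => nex.
suff : limsup <= a by rewrite leNgt al.
apply: limsup_le; apply: filterS FQ => x Qx; rewrite leNgt; apply/negP => ax.
by apply: nex; exists x.
Qed.

End real_limsup.

(** Change of variable in a limit superior; both envelopes and scheme limits are
    transported by it through sign changes. *)
Lemma limf_esup_involution (R : realType) (T : choiceType) (X : filteredType T)
    (s : X -> X) (f : X -> \bar R) (F F' : set_system X) :
  involutive s -> (forall V, F V -> F' (s @^-1` V)) ->
  (forall V, F' V -> F (s @^-1` V)) ->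
  limf_esup (f \o s) F = limf_esup f F'.
Proof.
move=> sK FF' F'F; rewrite !limf_esupE; congr ereal_inf.
have E V : (f \o s) @` V = f @` (s @^-1` V).
  apply/seteqP; split=> _ [x Vx <-].
    by exists (s x) => //; rewrite /preimage /= sK.
  by exists (s x) => //=; rewrite sK.
apply/seteqP; split=> _ [V FV <-].
  by exists (s @^-1` V); [exact: FF' | rewrite E].
exists (s @^-1` V); first exact: F'F.
by rewrite E; congr (ereal_sup (f @` _)); apply/seteqP; split=> x; rewrite /preimage /= sK.
Qed.

Lemma continuous_pair (T U V : topologicalType) (f : T -> U) (g : T -> V) :
  continuous f -> continuous g -> continuous (fun x => (f x, g x)).
Proof.
move=> cf cg x.
exact: (@cvg_pair _ _ _ (nbhs x) (nbhs (f x)) (nbhs (g x)) _ _ _ f g (cf x) (cg x)).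
Qed.

(** * Changing the sign of the unknown *)

(** The operator satisfied by - u when u satisfies F; it exchanges sub- and
    super-solutions, and upper and lower envelopes. *)
Definition dual_operator (R : realType) (n : nat) (F : pde_operator R n) :
    pde_operator R n :=
  fun x u p X => - F x (- u) (- p) (- X).

Definition dual_scheme (R : realType) (n : nat) (Fh : scheme R n) : scheme R n :=
  fun h z r f => - Fh h z (- r) (- f).

Lemma dual_operatorK (R : realType) (n : nat) : involutive (@dual_operator R n).
Proof.
move=> F; apply/funext => x; apply/funext => u; apply/funext => p.
by apply/funext => X; rewrite /dual_operator !opprK.
Qed.

Lemma upper_env_dual (R : realType) (n : nat) (Om : set 'rV[R]_n)
    (F : pde_operator R n) x u p X :
  upper_env Om (dual_operator F) x u p X =
  (- lower_env Om F x (- u) (- p) (- X))%E.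
Proof.
pose s (j : 'rV[R]_n * R * 'rV[R]_n * 'M[R]_n) := (j.1.1.1, - j.1.1.2, - j.1.2, - j.2).
have sK : involutive s by move=> [[[a b] c] d]; rewrite /s /= !opprK.
have cs : continuous s.
  have c1 : continuous (fun j : 'rV[R]_n * R * 'rV[R]_n * 'M[R]_n => j.1).
    by move=> j; exact: cvg_fst.
  have c11 : continuous (fun j : 'rV[R]_n * R * 'rV[R]_n * 'M[R]_n => j.1.1).
    by move=> j; apply: continuous_comp (c1 j) _; exact: cvg_fst.
  have cN (V : normedModType R) (f : 'rV[R]_n * R * 'rV[R]_n * 'M[R]_n -> V) :
      continuous f -> continuous (fun j => - f j).
    by move=> cf j; apply: (@continuous_comp _ _ _ f -%R j (cf j)); exact: opp_continuous.
  apply: continuous_pair; [apply: continuous_pair; [apply: continuous_pair|]|].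
  - by move=> j; apply: (@continuous_comp _ _ _ (fun j => j.1.1) fst j (c11 j)); exact: cvg_fst.
  - apply: cN => j; apply: (@continuous_comp _ _ _ (fun j => j.1.1) snd j (c11 j)).
    exact: cvg_snd.
  - by apply: cN => j; apply: (@continuous_comp _ _ _ fst snd j (c1 j)); exact: cvg_snd.
  - by apply: cN => j; exact: cvg_snd.
have H v q Y V : jet_nbhs Om x v q Y V ->
    jet_nbhs Om x (- v) (- q) (- Y) (s @^-1` V).
  move=> NV.
  have sE : s (x, - v, - q, - Y) = (x, v, q, Y) by rewrite /s /= !opprK.
  have NV' : nbhs (s (x, - v, - q, - Y)) [set j | closure Om j.1.1.1 /\ symmx j.2 -> V j].
    by rewrite sE.
  have {}NV' : nbhs (x, - v, - q, - Y)
    (s @^-1` [set j | closure Om j.1.1.1 /\ symmx j.2 -> V j]) := cs _ _ NV'.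
  apply: filterS NV' => j Vj [cj sj]; apply: Vj; split=> //.
  by rewrite /symmx linearN /= sj.
rewrite /upper_env /lower_env -limf_esupN.
apply: etrans (limf_esup_involution _ sK (H u p X) _); first by [].
by move=> V /H; rewrite !opprK.
Qed.

Lemma lower_env_dual (R : realType) (n : nat) (Om : set 'rV[R]_n)
    (F : pde_operator R n) x u p X :
  lower_env Om (dual_operator F) x u p X =
  (- upper_env Om F x (- u) (- p) (- X))%E.
Proof.
by rewrite -{2}(dual_operatorK F) upper_env_dual !opprK oppeK.
Qed.

Lemma supersolution_dual (R : realType) (n : nat) (Om : set 'rV[R]_n)
    (F : pde_operator R n) (v : 'rV[R]_n -> R) :
  viscosity_supersolution Om F v -> viscosity_subsolution Om (dual_operator F) (- v).
Proof.
move=> [[M vM] vlsc vsup]; split.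
- by exists M => x /vM; rewrite -[(- v) x]/(- v x) normrN.
- move=> x a Ax; rewrite -[(- v) x]/(- v x) ltrNl => /(vlsc _ _ Ax).
  by apply: filterS => y H; rewrite -[(- v) y]/(- v y) ltrNl.
- move=> phi Cphi x Ax vmax.
  have : local_min_on (closure Om) (v \- (- phi)) x.
    apply: filterS vmax => y H.
    have : - v y - phi y <= - v x - phi x := H.
    rewrite -[(v \- (- phi)) x]/(v x - - phi x) -[(v \- (- phi)) y]/(v y - - phi y).
    by move: (v x) (v y) (phi x) (phi y) => *; lra.
  move=> /(vsup _ (CkN Cphi) x Ax); rewrite lower_env_dual (gradN x Cphi) (hessN x Cphi).
  by rewrite -[(- v) x]/(- v x) opprK oppe_le0.
Qed.

Lemma subsolution_dual (R : realType) (n : nat) (Om : set 'rV[R]_n)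
    (F : pde_operator R n) (u : 'rV[R]_n -> R) :
  viscosity_subsolution Om (dual_operator F) u -> viscosity_supersolution Om F (- u).
Proof.
move=> [[M uM] uusc usub]; split.
- by exists M => x /uM; rewrite -[(- u) x]/(- u x) normrN.
- move=> x a Ax; rewrite -[(- u) x]/(- u x) ltrNr => /(uusc _ _ Ax).
  by apply: filterS => y H; rewrite -[(- u) y]/(- u y) ltrNr.
- move=> phi Cphi x Ax umin.
  have : local_max_on (closure Om) (u \- (- phi)) x.
    apply: filterS umin => y H.
    have : - u x - phi x <= - u y - phi y := H.
    rewrite -[(u \- (- phi)) x]/(u x - - phi x) -[(u \- (- phi)) y]/(u y - - phi y).
    by move: (u x) (u y) (phi x) (phi y) => *; lra.
  move=> /(usub _ (CkN Cphi) x Ax); rewrite lower_env_dual (gradN x Cphi) (hessN x Cphi).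
  by rewrite -[(- u) x]/(- u x) !opprK oppe_le0.
Qed.

Lemma comparison_dual (R : realType) (n : nat) (Om : set 'rV[R]_n)
    (F : pde_operator R n) :
  interior_comparison Om F -> interior_comparison Om (dual_operator F).
Proof.
move=> cmp u v su sv x Ox; rewrite -lerN2; apply: (cmp (- v) (- u)) => //.
  by rewrite -(dual_operatorK F); exact: supersolution_dual.
exact: subsolution_dual.
Qed.

Lemma strict_subsolution_dual (R : realType) (n : nat) (Om : set 'rV[R]_n)
    (F : pde_operator R n) (w : 'rV[R]_n -> R) :
  strict_classical_subsolution Om F w ->
  strict_classical_supersolution Om (dual_operator F) (- w).
Proof.
move=> [Cw [mu [mu0 H]]]; split; first exact: CkN.
exists mu; split=> // x /H; rewrite lower_env_dual (gradN x Cw) (hessN x Cw).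
by rewrite -[(- w) x]/(- w x) !opprK leeNr.
Qed.

Lemma scheme_filter_opp (R : realType) (n : nat) (Om : set 'rV[R]_n)
    (G : R -> set 'rV[R]_n) (x : 'rV[R]_n) V :
  scheme_filter Om G x V ->
  scheme_filter Om G x ((fun t => (t.1, - t.2)) @^-1` V).
Proof.
move=> [[A B] /= [hA hB] sub]; exists (A, -%R @^-1` B) => /=.
  split=> //; have /opp_continuous : nbhs (- (0 : R)) B by rewrite oppr0.
  exact.
move=> [t xi] /= [At Bxi] Gt; apply: (sub (t, - xi)) => //; exact: Gt.
Qed.

Lemma consistent_dual (R : realType) (n : nat) (Om : set 'rV[R]_n)
    (F : pde_operator R n) (G : R -> set 'rV[R]_n) (Fh : scheme R n) :
  consistent Om F G Fh -> consistent Om (dual_operator F) G (dual_scheme Fh).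
Proof.
move=> cons phi sphi x Ax.
have Cphi := sphi 2.
have [] := cons (- phi) (fun k => CkN (sphi k)) x Ax.
rewrite (gradN x Cphi) (hessN x Cphi) -[(- phi) x]/(- phi x) => up low.
rewrite upper_env_dual lower_env_dual.
pose s (t : R * 'rV[R]_n * 'rV[R]_n * R) := (t.1, - t.2).
have sK : involutive s by move=> [a b]; rewrite /s /= opprK.
have E : scheme_value (dual_scheme Fh) phi = (\- scheme_value Fh (- phi)%R)%E \o s.
  apply/funext => -[[[h y] z] xi]; rewrite /scheme_value /dual_scheme /=.
  rewrite -[(- phi) y]/(- phi y) opprD; congr (- Fh _ _ _ _)%:E.
  by apply/funext => w; rewrite -[LHS]/(- (phi y - phi w)) -[(- phi) w]/(- phi w) opprB addrC opprK.
have E1 : limf_esup (scheme_value (dual_scheme Fh) phi) (scheme_filter Om G x) =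
   (- limf_einf (scheme_value Fh (- phi)%R) (scheme_filter Om G x))%E.
  rewrite E -limf_esupN; apply: limf_esup_involution sK _ _;
    exact: scheme_filter_opp.
have E2 : limf_einf (scheme_value (dual_scheme Fh) phi) (scheme_filter Om G x) =
   (- limf_esup (scheme_value Fh (- phi)%R) (scheme_filter Om G x))%E.
  rewrite /limf_einf; congr (- _)%E.
  have -> : (\- scheme_value (dual_scheme Fh) phi)%E = scheme_value Fh (- phi) \o s.
    by rewrite E; apply/funext => t; exact: oppeK.
  by apply: limf_esup_involution sK _ _; exact: scheme_filter_opp.
by rewrite E1 E2; split; rewrite leeN2.
Qed.

Lemma monotone_dual (R : realType) (n : nat) (G : R -> set 'rV[R]_n)
    (Fh : scheme R n) :
  monotone_scheme G Fh -> monotone_scheme G (dual_scheme Fh).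
Proof.
apply: filterS => h mono z r s f g Gz rs fg; rewrite /dual_scheme lerN2.
by apply: mono; rewrite ?lerN2 // => w Gw; rewrite -[leLHS]/(- g w) -[leRHS]/(- f w) lerN2 fg.
Qed.

Lemma scheme_solution_dual (R : realType) (n : nat) (G : R -> set 'rV[R]_n)
    (Fh : scheme R n) (U : R -> 'rV[R]_n -> R) :
  scheme_solution G Fh U ->
  scheme_solution G (dual_scheme Fh) (fun h x => - U h x).
Proof.
apply: filterS => h sol x Gx; rewrite /dual_scheme opprK.
have -> : - (fun y => - U h x - - U h y) = (fun y => U h x - U h y).
  by apply/funext => y; rewrite -[LHS]/(- (- U h x - - U h y)) opprB addrC opprK.
by rewrite sol ?oppr0.
Qed.

Lemma lsc_ext_dual (R : realType) (n : nat) (Om : set 'rV[R]_n)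
    (u : 'rV[R]_n -> R) :
  lsc_ext Om u = - usc_ext Om (- u).
Proof. by apply/funext => x; rewrite /lsc_ext /limf_einf fineN. Qed.

(** * Penalized maxima and density of the grids *)

(** The lower envelope is lower semicontinuous, so it stays positive under the small
    increase of the Hessian made in [quartic_majorant]. *)
Lemma lower_env_add_scalar (R : realType) (n : nat) (Om : set 'rV[R]_n)
    (F : pde_operator R n) x u p X :
  (0 < lower_env Om F x u p X)%E ->
  exists2 e : R, 0 < e & (0 < lower_env Om F x u p (X + e%:M))%E.
Proof.
move=> /limf_einf_gt0[c c0 cF].
pose J (e : R) : 'rV[R]_n * R * 'rV[R]_n * 'M[R]_n := (x, u, p, X + e *: 1%:M).
have cJ : continuous J.
  apply: continuous_pair; first by move=> e; exact: cst_continuous.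
  move=> e; apply: (@cvgD R _ _ (nbhs e) _ (fun=> X) (fun e => e *: 1%:M)).
    exact: cvg_cst.
  exact: scalel_continuous.
have J0 : J 0 = (x, u, p, X) by rewrite /J scale0r addr0.
have N : nbhs (J 0) [set j | closure Om j.1.1.1 /\ symmx j.2 ->
    c < F j.1.1.1 j.1.1.2 j.1.2 j.2] by rewrite J0.
have {}N : \forall e \near (0 : R), nbhs (J e)
    [set j | closure Om j.1.1.1 /\ symmx j.2 -> c < F j.1.1.1 j.1.1.2 j.1.2 j.2].
  exact: cJ (nbhs_interior N).
have [e [e0 Ne]] : exists e : R, 0 < e /\ nbhs (J e)
    [set j | closure Om j.1.1.1 /\ symmx j.2 -> c < F j.1.1.1 j.1.1.2 j.1.2 j.2].
  move/nbhs_ballP : N => [d /= d0 dN]; exists (d / 2); split; first by rewrite divr_gt0.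
  by apply: dN; rewrite /ball /= sub0r normrN gtr0_norm ?divr_gt0 //; lra.
exists e => //; rewrite -scalemx1.
apply: lt_le_trans (_ : (c%:E <= _)%E); first by rewrite lte_fin.
apply: limf_einf_ge; apply: filterS Ne => j H /H; exact: ltW.
Qed.

Lemma finite_argmax (R : realType) (T : eqType) (A : set T) (f : T -> R) :
  finite_set A -> A !=set0 -> exists2 z, A z & forall w, A w -> f w <= f z.
Proof.
move=> /finite_seqP[s ->].
elim: s => [|a s IH] [x]; first by [].
move=> _; have [->|s0] := eqVneq s [::].
  by exists a => [|w]; rewrite /= ?inE // => /eqP ->.
have [|z zs zmax] := IH.
  by case: s s0 {IH} => // b s _; exists b; rewrite /= inE eqxx.
have [az|za] := leP (f a) (f z).
  exists z => [|w]; first by rewrite /= inE zs orbT.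
  by rewrite /= inE => /orP[/eqP -> //|]; exact: zmax.
exists a => [|w]; first by rewrite /= inE eqxx.
by rewrite /= inE => /orP[/eqP -> //|/zmax/le_trans]; apply; exact: ltW.
Qed.

(** The penalization eps |. - x0|^2 forces a maximum point of f into the ball of
    radius r, as soon as f gets within eps r^2 of its penalized bound m. *)
Lemma penalized_argmax (R : realType) (n : nat) (A : set 'rV[R]_n)
    (f : 'rV[R]_n -> R) (x0 w0 : 'rV[R]_n) (eps r m eta : R) :
  finite_set A -> 0 < eps -> 0 < r -> eta <= eps * r ^+ 2 ->
  (forall w, A w -> f w + eps * `|w - x0| ^+ 2 <= m) ->
  A w0 -> m - eta < f w0 ->
  exists z, [/\ A z, forall w, A w -> f w <= f z, `|z - x0| < r & m - eta < f z].
Proof.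
move=> fA eps0 r0 etar fm Aw0 fw0.
have [|z Az zmax] := @finite_argmax _ _ A f fA; first by exists w0.
have fz : m - eta < f z := lt_le_trans fw0 (zmax _ Aw0).
exists z; split => //; rewrite ltNge; apply/negP => rz.
have : eps * r ^+ 2 <= eps * `|z - x0| ^+ 2.
  by rewrite ler_wpM2l ?(ltW eps0) // !expr2 ler_pM // ltW.
by have := fm z Az; lra.
Qed.

Lemma enorm_ge_norm (R : realType) (n : nat) (x : 'rV[R]_n) : `|x| <= enorm x.
Proof.
apply: norm_le_coord => [|i]; first exact: sqrtr_ge0.
rewrite -sqrtr_sqr ler_wsqrtr // (bigD1 i) //= lerDl.
by rewrite sumr_ge0 // => j _; exact: sqr_ge0.
Qed.

Lemma enorm_le (R : realType) (n : nat) (x : 'rV[R]_n) (B : R) :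
  `|x| <= B -> enorm x <= Num.sqrt (n%:R * B ^+ 2).
Proof.
move=> xB; apply: ler_wsqrtr.
have -> : n%:R * B ^+ 2 = \sum_(i < n) B ^+ 2 by rewrite sumr_const card_ord mulr_natl.
apply: ler_sum => i _; rewrite -real_normK ?num_real // !expr2.
by rewrite ler_pM //; apply: le_trans xB; exact: coord_le_norm.
Qed.

(** The distance to the grid is below r uniformly in Om: its supremum tends to 0, and
    the supremum is a genuine one because Om and the grids are bounded. *)
Lemma grid_near (R : realType) (n : nat) (Om : set 'rV[R]_n)
    (G : R -> set 'rV[R]_n) (r : R) :
  bounded_set Om -> bounded_set (closure Om) -> discretisation Om G -> 0 < r ->
  \forall h \near (0 : R)^'+, forall x, Om x ->
    exists2 z, G h z & enorm (z - x) < r.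
Proof.
move=> bO bcO [gr /cvgrPdist_lt lim0] r0.
have [M bM] : exists M : R, forall x, closure Om x -> `|x| <= M.
  by have [M [_ /(_ (M + 1))]] := bcO; rewrite ltrDl => /(_ ltr01); exists (M + 1).
have := lim0 r r0; apply: filterS2 gr => h [Gfin [z0 Gz0] Gcl] hsup x Ox.
pose D y := [set enorm (z - y) | z in G h].
have D0 y : has_lbound (D y) by exists 0 => _ [z _ <-]; exact: sqrtr_ge0.
have infx : inf (D x) < r.
  apply: le_lt_trans (_ : sup [set inf (D y) | y in Om] < r); last first.
    by move: hsup; rewrite sub0r normrN; apply: le_lt_trans; exact: ler_norm.
  apply: ub_le_sup; last by exists x.
  exists (Num.sqrt (n%:R * (M + M) ^+ 2)) => _ [y Oy <-].
  apply: le_trans (_ : enorm (z0 - y) <= _).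
    by apply: ge_inf; [exact: D0 | exists z0].
  apply: enorm_le; apply: le_trans (ler_normB _ _) _.
  by rewrite lerD // bM //; [exact: Gcl | exact: subset_closure].
have [|_ [z Gz <-] zr] := inf_lt _ infx; first by exists (enorm (z0 - x)), z0.
by exists z.
Qed.

(** * Grid points near a point, and the touching principle *)

Lemma grid_dense (R : realType) (n : nat) (Om : set 'rV[R]_n)
    (G : R -> set 'rV[R]_n) (x : 'rV[R]_n) (r : R) :
  bounded_set Om -> bounded_set (closure Om) -> discretisation Om G -> closure Om x ->
  0 < r -> \forall h \near (0 : R)^'+, exists2 z, G h z & `|z - x| < r.
Proof.
move=> bO bcO grid Ax r0.
have r2 : 0 < r / 2 by rewrite divr_gt0.
have [y [Oy /= yx]] : Om `&` [set y | `|y - x| < r / 2] !=set0.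
  by apply: Ax; apply/near_normP; exists (r / 2).
apply: filterS (grid_near bO bcO grid r2) => h /(_ y Oy)[z Gz zy]; exists z => //.
rewrite (splitr r); apply: le_lt_trans (ler_distD y _ _) _.
by rewrite ltrD //; apply: le_lt_trans zy; exact: enorm_ge_norm.
Qed.

Definition grid_filter (R : realType) (n : nat) (G : R -> set 'rV[R]_n)
    (x : 'rV[R]_n) : set_system (R * 'rV[R]_n) :=
  within [set t | G t.1 t.2] (filter_prod (0 : R)^'+ (nbhs x)).

(** Grid points near x, for small h: the radius can be chosen before h. *)
Lemma grid_filterP (R : realType) (n : nat) (G : R -> set 'rV[R]_n)
    (x : 'rV[R]_n) (Q : R -> 'rV[R]_n -> Prop) :
  (\forall t \near grid_filter G x, Q t.1 t.2) <->
  exists2 r : R, 0 < r &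
    \forall h \near (0 : R)^'+, forall z, G h z -> `|z - x| < r -> Q h z.
Proof.
split=> [[[A B] /= [hA /near_normP[r r0 rB]] sub]|[r r0 near_Q]].
  exists r => //; apply: filterS hA => h Ah z Gz zr.
  by apply: (sub (h, z)) => //; split=> //=; exact: rB.
exists ([set h | forall z, G h z -> `|z - x| < r -> Q h z], [set z | `|z - x| < r]).
  by split=> //=; apply/near_normP; exists r.
by move=> [h z] /= [Qh zr] Gz; exact: Qh.
Qed.

Lemma grid_filter_proper (R : realType) (n : nat) (Om : set 'rV[R]_n)
    (G : R -> set 'rV[R]_n) (x : 'rV[R]_n) :
  bounded_set Om -> bounded_set (closure Om) -> discretisation Om G -> closure Om x ->
  ProperFilter (grid_filter G x).
Proof.
move=> bO bcO grid Ax.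
have FF : Filter (grid_filter G x) by exact: within_filter.
apply: (Build_ProperFilter_ex _ FF) => P GP.
have /(grid_filterP G x (fun h z => P (h, z)))[r r0 nP] :
    \forall t \near grid_filter G x, P (t.1, t.2).
  by apply: filterS GP => -[].
have F0 : ProperFilter (0 : R)^'+ by exact: at_right_proper_filter.
have nPz := @filterI _ (0 : R)^'+ F0 _ _ nP (grid_dense bO bcO grid Ax r0).
have [h [Ph [z Gz zr]]] := filter_ex nPz.
by exists (h, z); exact: Ph.
Qed.

(** Only the diagonal y = z of the consistency limit is of use, with xi left to absorb
    the difference between a grid function and the test function. *)
Lemma scheme_filter_near (R : realType) (n : nat) (Om : set 'rV[R]_n)
    (G : R -> set 'rV[R]_n) (x : 'rV[R]_n)
    (Q : R -> 'rV[R]_n -> R -> Prop) :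
  discretisation Om G ->
  (\forall t \near scheme_filter Om G x, t.1.1.2 = t.1.2 -> Q t.1.1.1 t.1.2 t.2) ->
  exists2 r : R, 0 < r &
    \forall h \near (0 : R)^'+, forall z xi, G h z -> `|z - x| < r -> `|xi| < r ->
      Q h z xi.
Proof.
move=> [gr _] [[S X] /= [[[S1 Z] /= [[[H Y] /= [hH hY] sub1] hZ] sub2] hX] sub3].
move: hY hZ hX => /near_normP[a a0 aY] /near_normP[b b0 bZ] /nbhs_ballP[c /= c0 cX].
exists (Num.min a (Num.min b c)); first by rewrite !lt_min a0 b0 c0.
apply: filterS2 gr hH => h [_ _ Gcl] Hh z xi Gz; rewrite !lt_min.
move=> /and3P[za zb _] /and3P[_ _ xc].
apply: (sub3 (h, z, z, xi)) => //; last by split=> //; exact: Gcl.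
split; last by apply: cX; rewrite /ball /= sub0r normrN.
apply: (sub2 (h, z, z)); split; last exact: bZ.
by apply: (sub1 (h, z)); split=> //; exact: aY.
Qed.

(** Local statements about grid points hold uniformly on a compact set, by extracting
    a finite cover; this replaces extraction of convergent subsequences. *)
Lemma compact_grid (R : realType) (n : nat) (G : R -> set 'rV[R]_n)
    (K : set 'rV[R]_n) (Q : R -> 'rV[R]_n -> Prop) :
  compact K ->
  (forall x, K x -> \forall t \near grid_filter G x, Q t.1 t.2) ->
  \forall h \near (0 : R)^'+, forall z, K z -> G h z -> Q h z.
Proof.
move=> /compact_near_coveringP cK KQ.
apply: (cK _ _ (fun h z => G h z -> Q h z)) => x /KQ/(grid_filterP G x Q)[r r0 nQ].
exists ([set z | `|z - x| < r],
        [set h | forall z, G h z -> `|z - x| < r -> Q h z]) => /=.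
  by split=> //; apply/near_normP; exists r.
by move=> [z h] /= [zr Qh] Gz; exact: Qh.
Qed.

(** At a maximum point z of W - P over the grid, W(z) - W(.) >= P(z) - P(.), so
    monotonicity bounds F^h on W from below by F^h on P, which consistency makes
    positive.  W(z) may lie slightly below P(z): the shift xi in the definition of
    consistency allows for it. *)
Lemma scheme_pos_of_touching (R : realType) (n : nat) (Om : set 'rV[R]_n)
    (F : pde_operator R n) (G : R -> set 'rV[R]_n) (Fh : scheme R n)
    (P : 'rV[R]_n -> R) (x0 : 'rV[R]_n) :
  discretisation Om G -> consistent Om F G Fh -> monotone_scheme G Fh ->
  smooth P -> closure Om x0 ->
  (0 < lower_env Om F x0 (P x0) (grad P x0) (hess P x0))%E ->
  exists2 r : R, 0 < r & \forall h \near (0 : R)^'+, forall (W : 'rV[R]_n -> R) z,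
    G h z -> `|z - x0| < r -> (forall w, G h w -> W w - P w <= W z - P z) ->
    - r < W z - P z -> 0 < Fh h z (W z) (fun w => W z - W w).
Proof.
move=> grid cons mono sP Ax0 pos.
have := lt_le_trans pos (cons P sP x0 Ax0).2 => /limf_einf_gt0[c c0 cF].
have nF : \forall t \near scheme_filter Om G x0, t.1.1.2 = t.1.2 ->
    0 < Fh t.1.1.1 t.1.2 (P t.1.2 + t.2) (fun w => P t.1.2 - P w).
  by apply: filterS cF => -[[[h y] z] xi] /= {}cF yz; rewrite yz in cF; exact: lt_trans cF.
have {nF} [r r0 nF] := scheme_filter_near (Q := fun h z xi =>
  0 < Fh h z (P z + xi) (fun w => P z - P w)) grid nF.
exists (r / 2); first by rewrite divr_gt0.
apply: filterS2 mono nF => h mono nF W z Gz zr zmax Wz.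
have r2 : 0 < r / 2 by rewrite divr_gt0.
(* The shift is xi = - r / 2. *)
have F1 : 0 < Fh h z (P z + - (r / 2)) (fun w => P z - P w).
  apply: nF => //; first by apply: lt_trans zr _; lra.
  by rewrite normrN gtr0_norm //; lra.
apply: lt_le_trans F1 _; apply: mono => // [|w Gw].
  by move: Wz; move: (W z) (P z) => *; lra.
by have := zmax w Gw; move: (W z) (P z) (W w) (P w) => *; lra.
Qed.

(** * Stability and the half-relaxed limit *)

Lemma bounded_closure (R : realType) (n : nat) (Om : set 'rV[R]_n) :
  bounded_set Om -> bounded_set (closure Om).
Proof.
move=> [M [_ MO]]; exists (M + 1 + 1); split; first exact: num_real.
move=> N MN x Ax.
have [y [Oy /= yx]] : Om `&` [set y | `|y - x| < 1] !=set0.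
  by apply: Ax; apply/near_normP; exists 1.
have yM : `|y| <= M + 1 by apply: MO => //; rewrite ltrDl.
have := ler_distD y x 0; rewrite !subr0 (distrC x y).
by move: MN yM yx; move: `|x| `|y| `|y - x| => *; lra.
Qed.

Lemma closure_compact (R : realType) (n : nat) (Om : set 'rV[R]_n) :
  bounded_set Om -> compact (closure Om).
Proof.
move=> bO; apply: bounded_closed_compact; first exact: bounded_closure.
exact: closed_closure.
Qed.

(** Discrete maximum principle.  A maximum point z of U^h - w over the grid where
    this difference is positive is near some x0 for small h.  As w is not smooth,
    the contradiction is not found at z but at a maximum point z' of U^h - P, where
    P is a polynomial majorant of w at x0; the strictness of the majorant keeps z'
    near x0. *)
Lemma scheme_le_strict_supersolution (R : realType) (n : nat)
    (Om : set 'rV[R]_n) (F : pde_operator R n) (G : R -> set 'rV[R]_n)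
    (Fh : scheme R n) (U : R -> 'rV[R]_n -> R) (w : 'rV[R]_n -> R) :
  bounded_set Om -> discretisation Om G -> consistent Om F G Fh ->
  monotone_scheme G Fh -> scheme_solution G Fh U ->
  strict_classical_supersolution Om F w ->
  \forall h \near (0 : R)^'+, forall z, G h z -> U h z <= w z.
Proof.
move=> bO grid cons mono sol [Cw [mu [mu0 wmu]]].
have cO := closure_compact bO.
have [gr _] := grid.
have [M wM] := compact_continuous_bounded cO (Ck_continuous Cw).
pose top h z := forall z', G h z' -> U h z' - w z' <= U h z - w z.
(* It suffices to bound U^h at the points where U^h - w is largest, which allows a
   local argument around each x0. *)
suff H : \forall h \near (0 : R)^'+, forall z, closure Om z -> G h z ->
    top h z -> U h z <= w z.
  apply: filterS2 gr H => h [Gfin G0 Gcl] H z Gz.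
  have [z' Gz' z'max] := finite_argmax (fun z => U h z - w z) Gfin G0.
  have := H z' (Gcl _ Gz') Gz' z'max; have := z'max z Gz.
  by move: (U h z) (U h z') (w z) (w z') => *; lra.
apply: compact_grid => // x0 Ax0.
have mu0' : (0 < mu%:E)%E by rewrite lte_fin.
have [e e0 pos] := lower_env_add_scalar (lt_le_trans mu0' (wmu x0 Ax0)).
have wM' x : closure Om x -> w x <= M by move=> /wM/ler_normlW.
have wmax : local_max_on (closure Om) (w \- w) x0.
  by apply: filterE => y; rewrite -[(w \- w) y]/(w y - w y) -[(w \- w) x0]/(w x0 - w x0) !subrr.
have [P sP [P0 gP hP [eps eps0 wP]]] := quartic_majorant cO wM' Cw wmax e0.
rewrite -P0 -gP -hP in pos.
have [r r0 nF] := scheme_pos_of_touching grid cons mono sP Ax0 pos.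
pose eta := Num.min r (eps * r ^+ 2).
have eta0 : 0 < eta by rewrite lt_min r0 mulr_gt0 // exprn_gt0.
have /near_normP[d d0 dP] : \forall y \near x0, `|(P + - w) y - (P + - w) x0| < eta.
  apply: near_continuous_dist eta0.
  exact: Ck_continuous (CkD (sP 2) (CkN Cw)).
apply/(grid_filterP G x0 (fun h z => top h z -> U h z <= w z)); exists d => //.
apply: filterS3 gr sol nF => h [Gfin G0 Gcl] {}sol {}nF z Gz zd ztop.
rewrite leNgt; apply/negP => wU.
have Pw : P z - w z < eta.
  have := dP z zd; rewrite -[(P + - w) z]/(P z - w z) -[(P + - w) x0]/(P x0 - w x0) P0 subrr.
  by rewrite subr0; apply: le_lt_trans; exact: ler_norm.
pose m := U h z - w z.
have m0 : 0 < m by rewrite subr_gt0.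
have [z' [Gz' z'max z'r z'm]] : exists z', [/\ G h z',
    forall w', G h w' -> U h w' - P w' <= U h z' - P z', `|z' - x0| < r &
    m - eta < U h z' - P z'].
  apply: (@penalized_argmax _ _ (G h) (fun y => U h y - P y) x0 z eps) => //.
  - by rewrite ge_min lexx orbT.
  - move=> y Gy; have := ztop y Gy; have := wP y (Gcl y Gy); rewrite -/m.
    by move: (U h y) (P y) (w y) (eps * _) => *; lra.
  - by move: Pw; rewrite /m; move: (P z) (U h z) (w z) => *; lra.
have rm : - r < U h z' - P z'.
  by apply: lt_trans z'm; have : eta <= r; [rewrite ge_min lexx|lra].
by have := nF (U h) z' Gz' z'r z'max rm; rewrite sol // ltxx.
Qed.

Lemma continuous_dist (R : realType) (n : nat) (x0 : 'rV[R]_n) :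
  continuous (fun x : 'rV[R]_n => `|x - x0|).
Proof.
move=> y; apply/(@cvgrPdist_lt _ _ _ (nbhs y) (nbhs_filter y)) => e e0; apply/near_normP; exists e => // z zy.
apply: le_lt_trans zy; rewrite distrC; apply: le_trans (ler_dist_dist _ _) _.
by rewrite opprB addrA subrK.
Qed.

Definition upper_limit (R : realType) (n : nat) (G : R -> set 'rV[R]_n)
    (U : R -> 'rV[R]_n -> R) (x : 'rV[R]_n) : R :=
  fine (limf_esup (fun t => (U t.1 t.2)%:E) (grid_filter G x)).

(** If the lower envelope were positive at a test function touching the upper limit
    at x0, it would be so at a polynomial P touching strictly.  For small h, U^h lies
    below the penalized P up to a small error, and it comes close to P near x0;
    hence U^h - P has a maximum point near x0, where the scheme is positive instead
    of zero. *)
Lemma upper_limit_subsolution (R : realType) (n : nat)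
    (Om : set 'rV[R]_n) (F : pde_operator R n) (G : R -> set 'rV[R]_n)
    (Fh : scheme R n) (U : R -> 'rV[R]_n -> R) (M : R) :
  bounded_set Om -> discretisation Om G -> consistent Om F G Fh ->
  monotone_scheme G Fh -> scheme_solution G Fh U ->
  (\forall h \near (0 : R)^'+, forall z, G h z -> `|U h z| <= M) ->
  viscosity_subsolution Om F (upper_limit G U).
Proof.
move=> bO grid cons mono sol UM.
have cO := closure_compact bO; have bcO := bounded_closure bO.
have [gr _] := grid.
have PF x (Ax : closure Om x) := grid_filter_proper bO bcO grid Ax.
have UMx x : \forall t \near grid_filter G x, `|U t.1 t.2| <= M.
  apply/(grid_filterP G x (fun h z => `|U h z| <= M)); exists 1 => //.
  by apply: filterS UM => h H z Gz _; exact: H.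
have ubound x : closure Om x -> `|upper_limit G U x| <= M.
  by move=> Ax; have FF := PF x Ax; exact: normr_limsup (UMx x).
have ult x a : closure Om x -> upper_limit G U x < a ->
    \forall t \near grid_filter G x, U t.1 t.2 < a.
  move=> Ax ua; have FF := PF x Ax.
  exact: (@limsup_lt _ _ _ (fun t => U t.1 t.2) _ M FF (UMx x) a ua).
split; first by exists M.
- move=> x a Ax; set b := (upper_limit G U x + a) / 2 => ua.
  have ub : upper_limit G U x < b by rewrite /b; lra.
  have ba : b < a by rewrite /b; lra.
  have /(grid_filterP G x (fun h z => U h z < b))[r r0 nU] := ult x b Ax ub.
  apply/near_normP; exists (r / 2) => [|y yx Ay]; first by rewrite divr_gt0.
  have FF := PF y Ay; apply: le_lt_trans ba; apply: (limsup_le (UMx y)).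
  apply/(grid_filterP G y (fun h z => U h z <= b)); exists (r / 2); first by rewrite divr_gt0.
  apply: filterS nU => h nU z Gz zy; apply/ltW/nU => //.
  by rewrite (splitr r); apply: le_lt_trans (ler_distD y _ _) _; exact: ltrD.
move=> phi Cphi x0 Ax0 umax; rewrite leNgt; apply/negP.
move=> /lower_env_add_scalar[e e0 pos].
have ubound' x : closure Om x -> upper_limit G U x <= M by move=> /ubound/ler_normlW.
have [P sP [P0 gP hP [eps eps0 uP]]] := quartic_majorant cO ubound' Cphi umax e0.
rewrite -P0 -gP -hP in pos.
have [r r0 nF] := scheme_pos_of_touching grid cons mono sP Ax0 pos.
pose eta := Num.min r (eps * r ^+ 2).
have eta0 : 0 < eta by rewrite lt_min r0 mulr_gt0 // exprn_gt0.
have eta3 : 0 < eta / 3 by rewrite divr_gt0.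
pose g : 'rV[R]_n -> R := fun y => P y - eps * `|y - x0| ^+ 2.
have cP : continuous P := Ck_continuous (sP 0).
have cg : continuous g.
  move=> y; have c1 : `|z - x0| @[z --> y] --> `|y - x0| by exact: continuous_dist.
  exact: cvgB (cP y) (cvgM (cvg_cst eps) (cvgM c1 c1)).
have above : \forall h \near (0 : R)^'+, forall z, closure Om z -> G h z ->
    U h z < g z + eta / 3.
  apply: compact_grid => // y Ay.
  have uy : upper_limit G U y < g y + eta / 3 / 2.
    have := uP y Ay; rewrite /g.
    by move: (upper_limit G U y) (P y) (eps * _) => *; lra.
  have eta6 : 0 < eta / 3 / 2 by rewrite divr_gt0.
  have /near_normP[d d0 dg] := near_continuous_dist y cg eta6.
  have /(grid_filterP G y (fun h z => U h z < _))[r' r'0 nU] := ult y _ Ay uy.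
  apply/(grid_filterP G y (fun h z => U h z < g z + eta / 3)).
  exists (Num.min d r'); first by rewrite lt_min d0 r'0.
  apply: filterS nU => h nU z Gz; rewrite lt_min => /andP[zd zr].
  have := nU z Gz zr; have := dg z zd; rewrite ltr_norml => /andP[+ _].
  by move: (U h z) (g z) (g y) => *; lra.
(* All that is needed at a pair (h, z) at which U^h(z) nearly reaches its upper
   limit at x0. *)
pose Q h z := [/\ finite_set (G h), G h `<=` closure Om & G h z] /\
  [/\ forall z, closure Om z -> G h z -> U h z < g z + eta / 3,
      forall x, G h x -> Fh h x (U h x) (fun y => U h x - U h y) = 0,
      forall (W : 'rV[R]_n -> R) z, G h z -> `|z - x0| < r ->
          (forall w, G h w -> W w - P w <= W z - P z) ->
          - r < W z - P z -> 0 < Fh h z (W z) (fun w => W z - W w) &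
      P z < P x0 + eta / 3].
have near_x0 : \forall t \near grid_filter G x0, Q t.1 t.2.
  have /near_normP[d d0 dP] := near_continuous_dist x0 cP eta3.
  apply/(grid_filterP G x0 Q); exists d => //.
  move: nF; apply: filter_app.
  apply: filterS3 gr above sol => h [Gfin _ Gcl] Uab {}sol nF z Gz zd; split => //.
  split => //; have := dP z zd; rewrite ltr_norml => /andP[_].
  by move: (P z) (P x0) => *; lra.
have FF := PF x0 Ax0.
have ux0 : upper_limit G U x0 - eta / 3 < upper_limit G U x0 by lra.
have [[h w0] /= [[Gfin Gcl Gw0] [Uab {}sol {}nF Pw0]] Uw0] :=
  limsup_gt_ex (UMx x0) ux0 near_x0.
have [z' [Gz' z'max z'r z'm]] : exists z', [/\ G h z',
    forall w', G h w' -> U h w' - P w' <= U h z' - P z', `|z' - x0| < r &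
    eta / 3 - eta < U h z' - P z'].
  apply: (@penalized_argmax _ _ (G h) (fun y => U h y - P y) x0 w0 eps) => //.
  - by rewrite ge_min lexx orbT.
  - move=> y Gy; have := Uab y (Gcl y Gy) Gy; rewrite /g.
    by move: (U h y) (P y) (eps * _) => *; lra.
  - move: Pw0 Uw0; rewrite P0.
    by move: (P w0) (U h w0) (upper_limit G U x0) => *; lra.
have rm : - r < U h z' - P z'.
  apply: lt_trans z'm; have : eta <= r; first by rewrite ge_min lexx.
  by lra.
by have := nF (U h) z' Gz' z'r z'max rm; rewrite sol // ltxx.
Qed.

(** * Perron's method through the scheme *)

(** The hypothesis is the conclusion of [scheme_pos_of_touching] for P at x0; the
    conclusion is that P - delta is a super-solution near x0, up to the boundary.
    If Q touches P - delta from below at y and the upper envelope is negative at Q,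
    consistency makes F^h negative on Q near y; but at a maximum point of Q - P over
    the grid F^h is positive on Q.  At a boundary point y this is more than
    positivity of the operator on the jet of P, since the gradient of Q may differ
    from that of P. *)
Lemma scheme_supersolution_of_pos (R : realType) (n : nat)
    (Om : set 'rV[R]_n) (F : pde_operator R n) (G : R -> set 'rV[R]_n)
    (Fh : scheme R n) (P psi : 'rV[R]_n -> R) (x0 y : 'rV[R]_n) (r delta : R) :
  bounded_set Om -> discretisation Om G -> consistent Om F G Fh ->
  monotone_scheme G Fh -> continuous P -> 0 < r ->
  (\forall h \near (0 : R)^'+, forall (W : 'rV[R]_n -> R) z,
    G h z -> `|z - x0| < r -> (forall w, G h w -> W w - P w <= W z - P z) ->
    - r < W z - P z -> 0 < Fh h z (W z) (fun w => W z - W w)) ->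
  closure Om y -> `|y - x0| < r / 2 -> delta <= r / 2 -> Ck 2 psi ->
  local_min_on (closure Om) ((fun x => P x - delta) \- psi) y ->
  (0 <= upper_env Om F y (P y - delta) (grad psi y) (hess psi y))%E.
Proof.
move=> bO grid cons mono cP r0 nF Ay yx0 dr Cpsi pmin.
have cO := closure_compact bO; have bcO := bounded_closure bO.
have [gr _] := grid.
rewrite leNgt; apply/negP.
rewrite -{1}(dual_operatorK F) upper_env_dual oppe_lt0 => /lower_env_add_scalar[e e0 pos].
have [M PM] := compact_continuous_bounded cO cP.
(* The polynomial is obtained for the dual problem: below, Q majorizes - (P - delta),
   and it is - Q that touches P - delta from below. *)
pose u x := - (P x - delta).
have uM x : closure Om x -> u x <= M + delta.
  move=> /PM; rewrite -normrN => /ler_normlW; rewrite /u.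
  by move: (P x) => *; lra.
have umax : local_max_on (closure Om) (u \- (- psi)) y.
  apply: filterS pmin => x.
  rewrite -[(u \- (- psi)) x]/(- (P x - delta) - - psi x).
  rewrite -[(u \- (- psi)) y]/(- (P y - delta) - - psi y) /=.
  by move: (P x) (P y) (psi x) (psi y) => *; lra.
have [Q sQ [Qy gQ hQ [eps eps0 uQ]]] := quartic_majorant cO uM (CkN Cpsi) umax e0.
rewrite -/(u y) -(gradN y Cpsi) -(hessN y Cpsi) -Qy -gQ -hQ in pos.
have [r2 r20 nQ] := scheme_pos_of_touching grid (consistent_dual cons)
  (monotone_dual mono) sQ Ay pos.
pose rho := Num.min r2 (r / 2).
have rho0 : 0 < rho by rewrite lt_min r20 divr_gt0.
pose eta := Num.min (r / 2) (eps * rho ^+ 2).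
have eta0 : 0 < eta by rewrite lt_min divr_gt0 //= mulr_gt0 // exprn_gt0.
pose f x := - Q x - P x.
have cf : continuous f.
  have cQ : continuous Q := Ck_continuous (sQ 0).
  by move=> x; exact: cvgB (cvgN (cQ x)) (cP x).
have fy : f y = - delta.
  by rewrite /f Qy /u; move: (P y) => p; ring.
have /near_normP[d d0 df] := near_continuous_dist y cf eta0.
have dense := grid_dense bO bcO grid Ay d0.
have F0 : ProperFilter (0 : R)^'+ by exact: at_right_proper_filter.
have [h [[[Gfin _ Gcl] [w0 Gw0 w0d]] [nFh nQh]]] := @filter_ex _ _ F0 _
  (@filterI _ _ F0 _ _ (@filterI _ _ F0 _ _ gr dense) (@filterI _ _ F0 _ _ nF nQ)).
have [z [Gz zmax zr fz]] : exists z, [/\ G h z, forall w, G h w -> f w <= f z,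
    `|z - y| < rho & - delta - eta < f z].
  apply: (@penalized_argmax _ _ (G h) f y w0 eps) => //.
  - by rewrite ge_min lexx orbT.
  - move=> w Gw; have := uQ w (Gcl w Gw); rewrite /f /u.
    by move: (Q w) (P w) (eps * _) => *; lra.
  - by have := df w0 w0d; rewrite fy ltr_norml => /andP[+ _]; move: (f w0) => *; lra.
have zx0 : `|z - x0| < r.
  rewrite (splitr r); apply: le_lt_trans (ler_distD y _ _) _.
  by rewrite ltrD //; apply: lt_le_trans zr _; rewrite ge_min lexx orbT.
have fzr : - r < f z.
  apply: le_lt_trans fz; have er : eta <= r / 2 by rewrite ge_min lexx.
  by clear -er dr; lra.
have pos1 := nFh (- Q) z Gz zx0 zmax fzr.
have zr2 : `|z - y| < r2 by apply: lt_le_trans zr _; rewrite ge_min lexx.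
have : 0 < dual_scheme Fh h z (Q z) (fun w => Q z - Q w).
  by apply: nQh => // [w _|]; rewrite ?subrr // oppr_lt0.
rewrite /dual_scheme oppr_gt0.
have -> : - (fun w => Q z - Q w) = (fun w => (- Q) z - (- Q) w).
  apply/funext => w; rewrite -[LHS]/(- (Q z - Q w)) -[RHS]/(- Q z - - Q w).
  by rewrite opprB addrC opprK.
by rewrite ltNge (ltW pos1).
Qed.

Lemma within_closure_proper (R : realType) (n : nat) (Om : set 'rV[R]_n)
    (x : 'rV[R]_n) :
  closure Om x -> ProperFilter (within Om (nbhs x)).
Proof.
move=> Ax; have FF : Filter (within Om (nbhs x)) by exact: within_filter.
apply: (Build_ProperFilter_ex _ FF) => P NP.
by have [y [Oy Py]] := Ax _ NP; exists y; exact: Py.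
Qed.

Lemma usc_ext_usc (R : realType) (n : nat) (Om : set 'rV[R]_n)
    (u : 'rV[R]_n -> R) (M : R) :
  (forall x, Om x -> `|u x| <= M) ->
  (forall x, closure Om x -> `|usc_ext Om u x| <= M) /\
  usc_on (closure Om) (usc_ext Om u).
Proof.
move=> uM.
have nM (x : 'rV[R]_n) : \forall y \near within Om (nbhs x), `|u y| <= M.
  by rewrite near_withinE; apply: nearW => y; exact: uM.
split=> [x Ax|x a Ax].
  by have FF := within_closure_proper Ax; exact: normr_limsup (nM x).
set b := (usc_ext Om u x + a) / 2 => ua.
have ub : usc_ext Om u x < b by rewrite /b; lra.
have ba : b < a by rewrite /b; lra.
have FF := within_closure_proper Ax.
have [r r0 ur] := (near_normP x (fun y => Om y -> u y < b)).1 (limsup_lt (nM x) ub).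
apply/near_normP; exists (r / 2) => [|y yx Ay]; first by rewrite divr_gt0.
have FF' := within_closure_proper Ay.
apply: le_lt_trans ba; apply: (limsup_le (nM y)).
apply/(near_normP y (fun z => Om z -> u z <= b)).
exists (r / 2) => [|z zy Oz]; first by rewrite divr_gt0.
apply/ltW/ur => //.
by rewrite (splitr r); apply: le_lt_trans (ler_distD y _ _) _; exact: ltrD.
Qed.

(** Perron's argument.  If the upper envelope of s is not a sub-solution at x0,
    lowering v near x0 to P - delta yields another super-solution V, and comparison
    of s with V contradicts that s comes close to P(x0) along Om. *)
Lemma usc_ext_subsolution (R : realType) (n : nat)
    (Om : set 'rV[R]_n) (F : pde_operator R n) (G : R -> set 'rV[R]_n)
    (Fh : scheme R n) (s v : 'rV[R]_n -> R) :
  bounded_set Om -> discretisation Om G -> consistent Om F G Fh ->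
  monotone_scheme G Fh -> interior_comparison Om F ->
  viscosity_subsolution Om F s -> viscosity_supersolution Om F v ->
  (forall x, Om x -> s x = v x) ->
  viscosity_subsolution Om F (usc_ext Om s).
Proof.
move=> bO grid cons mono cmp ssub vsup sv.
have cO := closure_compact bO.
have [[M sM] _ _] := ssub; have [[N vN] vlsc vtest] := vsup.
have sM' x : Om x -> `|s x| <= M by move=> Ox; apply/sM/subset_closure.
have nM (x : 'rV[R]_n) : \forall y \near within Om (nbhs x), `|s y| <= M.
  by rewrite near_withinE; apply: nearW => y; exact: sM'.
have [usM ususc] := usc_ext_usc sM'.
pose us := usc_ext Om s.
split; [by exists M | exact: ususc | move=> phi Cphi x0 Ax0 umax].
rewrite leNgt; apply/negP => /lower_env_add_scalar[e e0 pos].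
have usM' x : closure Om x -> us x <= M by move=> /usM/ler_normlW.
have [P sP [P0 gP hP [eps eps0 usP]]] := quartic_majorant cO usM' Cphi umax e0.
rewrite -/us -P0 -gP -hP in pos.
have cP : continuous P := Ck_continuous (sP 0).
have [r r0 nF] := scheme_pos_of_touching grid cons mono sP Ax0 pos.
have v_us x : closure Om x -> v x <= us x.
  move=> Ax; rewrite leNgt; apply/negP => uv.
  have FF := within_closure_proper Ax.
  pose a := (us x + v x) / 2.
  have ua : us x < a by rewrite /a; lra.
  have av : a < v x by rewrite /a; lra.
  have sa := @limsup_lt _ _ _ s _ M FF (nM x) a ua.
  have := vlsc x a Ax av; rewrite near_withinE => va.
  have va' : \forall y \near within Om (nbhs x), Om y /\ a < v y.
    rewrite near_withinE; apply: filterS va => y va Oy; split => //.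
    by apply: va; exact: subset_closure.
  have [y [sya [Oy]]] := filter_ex (@filterI _ _ (@filter_filter _ _ FF) _ _ sa va').
  by rewrite -sv // => /(lt_trans sya); rewrite ltxx.
(* Small enough for V to differ from v only within r / 2 of x0, where
   [scheme_supersolution_of_pos] applies. *)
pose delta := Num.min (r / 2) (eps * (r / 2) ^+ 2).
have delta0 : 0 < delta by rewrite lt_min divr_gt0 //= mulr_gt0 // exprn_gt0 // divr_gt0.
have deltar : delta <= r / 2 by rewrite ge_min lexx.
have deltae : delta <= eps * (r / 2) ^+ 2 by rewrite ge_min lexx orbT.
pose V x := Num.min (v x) (P x - delta).
have Vsup : viscosity_supersolution Om F V.
  split.
  - exists (N + M + delta) => x Ax; have := v_us x Ax.
    have := usM x Ax; have := vN x Ax; have := usP x Ax; rewrite -/us.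
    have : 0 <= eps * `|x - x0| ^+ 2 by rewrite mulr_ge0 ?sqr_ge0 // ltW.
    rewrite !ler_norml /V => H1 H2 /andP[H3 H4] /andP[H5 H6] H7.
    apply/andP; split; last first.
      by apply: (@le_trans _ _ (v x)); [rewrite ge_min lexx | clear -H3 H4 H5 H6 delta0; lra].
    by rewrite le_min; apply/andP; split; clear -H1 H2 H3 H4 H5 H6 H7 delta0; lra.
  - move=> x a Ax; rewrite /V lt_min => /andP[av aP].
    have Pd0 : 0 < P x - delta - a by rewrite subr_gt0.
    have := vlsc x a Ax av; have := near_continuous_dist x cP Pd0.
    rewrite !near_withinE; apply: filterS2 => y Py ay Ay; rewrite lt_min ay //=.
    move: Py; rewrite ltr_norml => /andP[+ _].
    by move: (P y) (P x) => *; lra.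
  - move=> psi Cpsi y Ay pmin.
    have [vP|Pv] := leP (v y) (P y - delta).
      have Vy : V y = v y by rewrite /V min_l.
      rewrite Vy; apply: vtest => //; apply: filterS pmin => z.
      rewrite -[(V \- psi) y]/(V y - psi y) Vy => /le_trans; apply.
      by rewrite lerD2r ge_min lexx.
    have Vy : V y = P y - delta by rewrite /V min_r // ltW.
    rewrite Vy; apply: (scheme_supersolution_of_pos bO grid cons mono cP r0 nF) => //.
      rewrite ltNge; apply/negP => ry.
      have : eps * (r / 2) ^+ 2 <= eps * `|y - x0| ^+ 2.
        by rewrite ler_wpM2l ?(ltW eps0) // !expr2 ler_pM // divr_ge0 // ltW.
      have := usP y Ay; rewrite -/us; have := v_us y Ay; move: deltae Pv.
      by move: (eps * _) (eps * _) (us y) (v y) (P y) => *; lra.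
    apply: filterS pmin => z.
    rewrite -[(V \- psi) y]/(V y - psi y) Vy => /le_trans; apply.
    by rewrite lerD2r ge_min lexx orbT.
have FF := within_closure_proper Ax0.
have d2 : 0 < delta / 2 by rewrite divr_gt0.
have close : \forall y \near within Om (nbhs x0), Om y /\ `|P y - P x0| < delta / 2.
  by rewrite near_withinE; apply: filterS (near_continuous_dist x0 cP d2) => y H Oy.
have u0 : us x0 - delta / 2 < us x0 by rewrite ltrBlDr ltrDl.
have [y [Oy Py] sy] := limsup_gt_ex (nM x0) u0 close.
have := cmp s V ssub Vsup y Oy; rewrite /V le_min => /andP[_].
move: Py sy; rewrite P0 -/us ltr_norml => /andP[_].
by move: (P y) (us x0) (s y) => *; lra.
Qed.

(** * Envelopes, extensions and convergence *)

Lemma usc_ext_congr (R : realType) (n : nat) (Om : set 'rV[R]_n)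
    (f g : 'rV[R]_n -> R) :
  (forall x, Om x -> f x = g x) -> usc_ext Om f = usc_ext Om g.
Proof.
move=> fg; apply/funext => x; rewrite /usc_ext !limf_esupE; congr fine.
suff le (a b : 'rV[R]_n -> R) : (forall x, Om x -> a x = b x) ->
    (ereal_inf [set ereal_sup [set (a y)%:E | y in V] | V in within Om (nbhs x)] <=
     ereal_inf [set ereal_sup [set (b y)%:E | y in V] | V in within Om (nbhs x)])%E.
  by apply/eqP; rewrite eq_le !le // => y Oy; rewrite fg.
move=> ab; apply: le_ereal_inf_tmp => _ [V NV <-].
have NV' : within Om (nbhs x) (V `&` Om).
  have NV' : nbhs x (fun y => Om y -> V y) := NV.
  by apply: filterS NV' => y Vy Oy; split=> //; exact: Vy.
apply: le_trans (ereal_inf_lbound _) _; first by exists (V `&` Om).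
by apply: le_ereal_sup => _ [y [Vy Oy] <-]; exists y; rewrite ?ab.
Qed.

(** The limit superior includes the value at x itself. *)
Lemma le_usc_ext (R : realType) (n : nat) (Om : set 'rV[R]_n)
    (u : 'rV[R]_n -> R) (x : 'rV[R]_n) :
  bounded_on Om u -> Om x -> u x <= usc_ext Om u x.
Proof.
move=> [M uM] Ox; rewrite leNgt; apply/negP => ux.
have FF := within_closure_proper (subset_closure Ox).
have nM : \forall y \near within Om (nbhs x), `|u y| <= M.
  by rewrite near_withinE; apply: nearW => y; exact: uM.
have uu : nbhs x (fun y => Om y -> u y < u x).
  exact: (@limsup_lt _ _ _ u _ M FF nM (u x) ux).
by have := nbhs_singleton uu Ox; rewrite ltxx.
Qed.

(** The points of A nearest to x lie in every ball around x that A meets. *)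
Lemma grid_extension_bounds (R : realType) (n : nat) (A : set 'rV[R]_n)
    (U : 'rV[R]_n -> R) (x : 'rV[R]_n) (r a b : R) :
  finite_set A -> (exists2 z, A z & enorm (z - x) < r) ->
  (forall z, A z -> `|z - x| < r -> a <= U z <= b) ->
  a <= grid_extension A U x <= b.
Proof.
move=> fA [z0 Az0 z0r] Uab.
have near_r y : nearest A x y -> a <= U y <= b.
  move=> [Ay ymin]; apply: Uab => //; apply: le_lt_trans (enorm_ge_norm _) _.
  exact: le_lt_trans (ymin z0 Az0) z0r.
have [y Ay ymax] : exists2 y, A y & forall w, A w -> - enorm (w - x) <= - enorm (y - x).
  by apply: finite_argmax fA _; exists z0.
have ny : nearest A x y by split=> // z /ymax; rewrite lerN2.
rewrite /grid_extension; apply/andP; split.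
  have /andP[aU _] := near_r y ny; apply: le_trans aU _.
  apply: ub_le_sup; last by exists y.
  by exists b => _ [w /near_r/andP[_ wb] <-].
apply: ge_sup; first by exists (U y), y.
by move=> _ [w /near_r/andP[_ wb] <-].
Qed.

Theorem theorem9 (R : realType) (n : nat) (Om : set 'rV[R]_n)
    (F : pde_operator R n) (G : R -> set 'rV[R]_n) (Fh : scheme R n)
    (U : R -> 'rV[R]_n -> R)
    (dom : bounded_domain Om)
    (ell : degenerate_elliptic Om F)
    (comparison : interior_comparison Om F)
    (strict_sub : exists w, strict_classical_subsolution Om F w)
    (strict_super : exists w, strict_classical_supersolution Om F w)
    (grid : discretisation Om G)
    (sch : grid_scheme G Fh)
    (cons : consistent Om F G Fh)
    (mono : monotone_scheme G Fh)
    (lip : lipschitz_scheme G Fh)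
    (sol : scheme_solution G Fh U) :
  exists u : 'rV[R]_n -> R,
    [/\ viscosity_solution Om F u,
        forall v, viscosity_solution Om F v -> forall x, Om x -> v x = u x &
        forall x, Om x ->
          grid_extension (G h) (U h) x @[h --> (0 : R)^'+] --> u x].
Proof.
have [_ _ _ bO] := dom.
have cO := closure_compact bO; have bcO := bounded_closure bO.
have [gr _] := grid.
have [consD monoD solD] :=
  And3 (consistent_dual cons) (monotone_dual mono) (scheme_solution_dual sol).
pose U' h x := - U h x.
have [M UM] : exists M : R, \forall h \near (0 : R)^'+, forall z, G h z -> `|U h z| <= M.
  have [w1 s1] := strict_super; have [w2 s2] := strict_sub.
  have [M1 b1] := compact_continuous_bounded cO (Ck_continuous s1.1).
  have [M2 b2] := compact_continuous_bounded cO (Ck_continuous s2.1).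
  have up := scheme_le_strict_supersolution bO grid cons mono sol s1.
  have low := scheme_le_strict_supersolution bO grid consD monoD solD
    (strict_subsolution_dual s2).
  exists (M1 + M2); apply: filterS3 gr up low => h [_ _ Gcl] up low z Gz.
  have := up z Gz; have : - U h z <= - w2 z := low z Gz.
  have := b1 z (Gcl z Gz); have := b2 z (Gcl z Gz).
  move: (U h z) (w1 z) (w2 z) => p q r; rewrite lerN2 !ler_norml.
  move=> /andP[? ?] /andP[? ?] ? ?; apply/andP; split.
    by apply: (@le_trans _ _ (- M2)) => //; lra.
  by lra.
have UM' : \forall h \near (0 : R)^'+, forall z, G h z -> `|U' h z| <= M.
  by apply: filterS UM => h UM z Gz; rewrite normrN; exact: UM.
pose u := upper_limit G U; pose l := upper_limit G U'.
have usub : viscosity_subsolution Om F u.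
  exact: upper_limit_subsolution bO grid cons mono sol UM.
have lsub : viscosity_subsolution Om (dual_operator F) l.
  exact: upper_limit_subsolution bO grid consD monoD solD UM'.
have lsup : viscosity_supersolution Om F (- l) by exact: subsolution_dual.
have usup : viscosity_supersolution Om (dual_operator F) (- u).
  by apply: subsolution_dual; rewrite dual_operatorK.
have bound (W : R -> 'rV[R]_n -> R) :
    (\forall h \near (0 : R)^'+, forall z, G h z -> `|W h z| <= M) ->
    forall x, \forall t \near grid_filter G x, `|W t.1 t.2| <= M.
  move=> WM x; apply/(grid_filterP G x (fun h z => `|W h z| <= M)).
  by exists 1 => //; apply: filterS WM => h WM z Gz _; exact: WM.
(* Comparison gives one inequality; the other is that an upper limit is at least the
   corresponding lower limit, here - l. *)
have uE x : Om x -> u x = - l x.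
  move=> Ox; apply/eqP; rewrite eq_le; apply/andP; split.
    exact: comparison usub lsup x Ox.
  have FF := grid_filter_proper bO bcO grid (subset_closure Ox).
  rewrite leNgt; apply/negP => ul; pose a := (u x - l x) / 2.
  have ua : u x < a by rewrite /a; lra.
  have la : l x < - a by rewrite /a; lra.
  have Ua := @limsup_lt _ _ _ (fun t => U t.1 t.2) _ M FF (bound U UM x) a ua.
  have La := @limsup_lt _ _ _ (fun t => U' t.1 t.2) _ M FF (bound U' UM' x) (- a) la.
  have [t [/= ta]] := filter_ex (@filterI _ _ (@filter_filter _ _ FF) _ _ Ua La).
  by rewrite ltrN2 => /(lt_trans ta); rewrite ltxx.
have lE x : Om x -> l x = (- u) x.
  by move=> /uE ux; rewrite -[RHS]/(- u x) ux opprK.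
exists u; split.
- split.
  + by have [[N uN] _ _] := usub; exists N => x /subset_closure; exact: uN.
  + exact: usc_ext_subsolution bO grid cons mono comparison usub lsup uE.
  + rewrite lsc_ext_dual; apply: subsolution_dual; rewrite -(usc_ext_congr lE).
    exact: usc_ext_subsolution bO grid consD monoD (comparison_dual comparison)
      lsub usup lE.
- move=> v [bv vsub vsup] x Ox; apply/eqP; rewrite eq_le; apply/andP; split.
    rewrite uE //; apply: le_trans (le_usc_ext bv Ox) _.
    exact: comparison vsub lsup x Ox.
  apply: le_trans (comparison u _ usub vsup x Ox) _.
  rewrite lsc_ext_dual -[leLHS]/(- usc_ext Om (- v) x) lerNl.
  apply: le_usc_ext => //; have [N vN] := bv; exists N => y /vN.
  by rewrite -[(- v) y]/(- v y) normrN.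
- move=> x Ox; apply/cvgrPdist_le => e e0.
  have FF := grid_filter_proper bO bcO grid (subset_closure Ox).
  have ue : u x < u x + e by rewrite ltrDl.
  have le : l x < l x + e by rewrite ltrDl.
  have Ua := @limsup_lt _ _ _ (fun t => U t.1 t.2) _ M FF (bound U UM x) _ ue.
  have La := @limsup_lt _ _ _ (fun t => U' t.1 t.2) _ M FF (bound U' UM' x) _ le.
  have [r r0 nU] := (grid_filterP G x (fun h z => U h z < u x + e /\ U' h z < l x + e)).1
    (@filterI _ _ (@filter_filter _ _ FF) _ _ Ua La).
  apply: filterS3 gr (grid_near bO bcO grid r0) nU => h [Gfin _ _] /(_ x Ox) dense nU.
  have /andP[low up] : u x - e <= grid_extension (G h) (U h) x <= u x + e.
    apply: grid_extension_bounds Gfin dense _ => z Gz zr.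
    have [/ltW Ue] := nU z Gz zr; rewrite Ue andbT.
    rewrite /U' (lE x Ox) -[(- u) x]/(- u x).
    by move: (u x) (U h z) => p q; lra.
  rewrite distrC ler_norml.
  by move: low up; move: (u x) (grid_extension _ _ _) => p q *; lra.
Qed.
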